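(* Consider the setting of the context, with the dimensions growing, under the following assumptions: (i) $\Phi\in\mathbb{R}^{M\times N}$ is a Gaussian random matrix, that is, its entries are i.i.d. drawn from the standard Gaussian distribution $\mathcal N(0,1)$; (ii) the confidence level $P=1-\pi$, with $\pi\in(0,1)$, is fixed, and in problem (P) one takes $\lambda=\sqrt{2\log(2N/\pi)}\,f_{\max}$; (iii) the true signal $x^*\in\mathbb{R}^N$ has $S$ nonzero components, and $S\log N=o(M)$; (iv) the saturation ratio $\chi:=\bar M/M=(M-\tilde M)/M$ is below a small positive threshold, in the sense that $\chi(1-\log\chi)\le\tau$ for a sufficiently small $\tau>0$; (v) the quantization errors $(\tilde\Phi x^*-\tilde y)_i$, $i=1,\dots,\tilde M$, are independently distributed with expectation $0$ (and, being errors of unsaturated measurements, are bounded in absolute value by $\Delta/2$); (vi) $x^*$ is feasible for problem (P). Let $\hat x$ be a solution of (P). Then, with high probability, for sufficiently high dimensions, \[ \|\hat x-x^*\|\le \min\left\{O\left(\sqrt{S(\log N)/M}\right),\,O(1)\right\}\Delta . \]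
   Context: Setting. A quantization interval $\Delta>0$ and number of bits $B$ are given, and $G:=2^{B-1}\Delta$. The rows of the sensing matrix $\Phi\in\mathbb{R}^{M\times N}$ are partitioned into an unsaturated part $\tilde\Phi\in\mathbb{R}^{\tilde M\times N}$ (measurements rounded to non-extreme representable values) and saturated parts $\bar\Phi_+,\bar\Phi_-$ (measurements recorded as the extreme values $G-\Delta/2$ and $-G+\Delta/2$ respectively), which together have $\bar M=M-\tilde M$ rows. $\tilde y\in\mathbb{R}^{\tilde M}$ is the vector of recorded (quantized) unsaturated measurements. Problem (P), with parameter $\lambda$, is \[ \min_{x\in\mathbb{R}^N}\ \tfrac12\|\tilde\Phi x-\tilde y\|^2+\lambda\Delta\|x\|_1\quad\text{s.t.}\quad \|\tilde\Phi x-\tilde y\|_\infty\le\Delta/2,\ \ \bar\Phi_+x\ge(G-\Delta)\mathbf 1,\ \ \bar\Phi_-x\le(\Delta-G)\mathbf 1, \] where $\mathbf 1$ is the all-ones vector and vector inequalities are componentwise. Notation. $\|\cdot\|$ is the $\ell_2$ norm and $\|\cdot\|_p$ the $\ell_p$ norm. $f_{\max}:=\max_{i}\|\tilde\Phi_i\|$, where $\tilde\Phi_i$ is the $i$th column of $\tilde\Phi$. Order notation is for positive quantities depending on the dimensions, in the limit as $N$ and $\tilde M$ both approach $\infty$: $\alpha=O(\beta)$ if $\alpha$ can be bounded by a fixed multiple of $\beta$ for all sufficiently large dimensions; $\alpha=o(\beta)$ if for every constant $\phi>0$, $\alpha\le\phi\beta$ for all sufficiently large dimensions.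
   Formalization: Assumption (v) is taken conditionally on Φ: given Φ and the saturation pattern, the quantization errors are independent with expectation 0; merely unconditional independence and zero mean, with errors depending on Φ as in exact rounding, would not give the claimed rate. *)

(* Defs.v *)
From HB Require Import structures.
From mathcomp Require Import all_boot all_order all_algebra.
From mathcomp Require Import all_classical all_reals all_analysis.

Set Implicit Arguments.
Unset Strict Implicit.
Unset Printing Implicit Defensive.

Import Order.TTheory GRing.Theory Num.Theory numFieldNormedType.Exports.

Local Open Scope classical_set_scope.
Local Open Scope ring_scope.

Section Vectors.
Variable R : realType.

Definition l1norm m (v : 'cV[R]_m) : R := \sum_i `|v i 0|.

Definition l2norm m (v : 'cV[R]_m) : R := Num.sqrt (\sum_i v i 0 ^+ 2).

Definition nnz m (v : 'cV[R]_m) : nat := #|[set i | v i 0 != 0]%SET|.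

(* The submatrix of A made of its rows with index in I, in increasing order. *)
Definition rows_of m n (I : {set 'I_m}) (A : 'M[R]_(m, n)) : 'M[R]_(#|I|, n) :=
  rowsub (@enum_val _ (mem I)) A.

Definition fmax m n (A : 'M[R]_(m, n)) : R :=
  \big[Num.max/0]_(j < n) l2norm (col j A).

End Vectors.

Section Recovery.
Variables (R : realType) (Delta : R) (B : nat).

(* G = 2^(B-1) Delta, for B >= 1 bits *)
Definition sat_level : R := 2 ^+ B.-1 * Delta.

Local Notation G := sat_level.

(* The partition of the rows is read off the vector y of all M recorded
   measurements. *)
Definition satp m (y : 'cV[R]_m) : {set 'I_m} :=
  [set i | y i 0 == G - Delta / 2]%SET.

Definition satm m (y : 'cV[R]_m) : {set 'I_m} :=
  [set i | y i 0 == - G + Delta / 2]%SET.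

Definition unsat m (y : 'cV[R]_m) : {set 'I_m} := ~: (satp y :|: satm y).

Definition sat_ratio m (y : 'cV[R]_m) : R :=
  (m%:R - #|unsat y|%:R) / m%:R.

(* The residual at x of the unsaturated part. *)
Definition residual m n (A : 'M[R]_(m, n)) (y : 'cV[R]_m) (x : 'cV[R]_n) :
    'cV[R]_#|unsat y| :=
  rows_of (unsat y) A *m x - rows_of (unsat y) y.

(* The norm `|.| of the library on matrices is the max norm. *)
Definition feasible m n (A : 'M[R]_(m, n)) (y : 'cV[R]_m) (x : 'cV[R]_n) :
    Prop :=
  [/\ `|residual A y x| <= Delta / 2,
      forall i, G - Delta <= (rows_of (satp y) A *m x) i 0 &
      forall i, (rows_of (satm y) A *m x) i 0 <= Delta - G].

Definition objective m n (lambda : R) (A : 'M[R]_(m, n)) (y : 'cV[R]_m)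
    (x : 'cV[R]_n) : R :=
  2^-1 * l2norm (residual A y x) ^+ 2 + lambda * Delta * l1norm x.

Definition is_solution m n (lambda : R) (A : 'M[R]_(m, n)) (y : 'cV[R]_m)
    (x : 'cV[R]_n) : Prop :=
  feasible A y x /\
  forall z, feasible A y z -> objective lambda A y x <= objective lambda A y z.

(* lambda = sqrt (2 log (2N / p)) fmax, where 1 - p is the confidence level *)
Definition lambda_of m n (p : R) (A : 'M[R]_(m, n)) (y : 'cV[R]_m) : R :=
  Num.sqrt (2 * ln (2 * n%:R / p)) * fmax (rows_of (unsat y) A).

End Recovery.

Section Probability.
Variable R : realType.

Definition mutually_independent d (T : measurableType d)
    (P : probability T R) (I : finType) (J : {set I}) (X : I -> T -> R) : Prop :=
  forall (K : {set I}) (E : I -> set R),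
    K \subset J -> (forall i, measurable (E i)) ->
    P (\bigcap_(i in [set` K]) X i @^-1` E i) =
    (\prod_(i in K) P (X i @^-1` E i))%E.

Definition gaussian_matrix d (T : measurableType d) (P : probability T R) m n
    (Phi : 'I_m -> 'I_n -> {RV P >-> R}) : Prop :=
  mutually_independent P [set: 'I_m * 'I_n]%SET (fun ij => Phi ij.1 ij.2) /\
  forall i j (E : set R), measurable E ->
    distribution P (Phi i j) E = normal_prob 0 1 E.

(* The conditional law of the errors once the design and the saturation pattern
   are fixed: T2 carries the randomness of the quantization errors only, and
   y w is the vector of recorded measurements at w in T2. *)
Definition centered_independent_errors d (T2 : measurableType d)
    (P2 : probability T2 R) (Delta : R) (B m n : nat) (A : 'M[R]_(m, n))
    (x : 'cV[R]_n) (y : T2 -> 'cV[R]_m) : Prop :=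
  exists2 J : {set 'I_m}, (forall w, unsat Delta B (y w) = J) &
    let err (i : 'I_m) (w : T2) : R := (A *m x - y w) i 0 in
    [/\ mutually_independent P2 J err,
        forall i, i \in J -> ('E_P2[err i] = 0)%E &
        forall i w, i \in J -> `|err i w| <= Delta / 2].

(* The inner probability of E n tends to 1. *)
Definition with_high_probability (d : nat -> measure_display)
    (T : forall n, measurableType (d n))
    (P : forall n, {measure set (T n) -> \bar R}) (E : forall n, set (T n)) :
    Prop :=
  exists A : forall n, set (T n),
    [/\ forall n, measurable (A n),
        forall n, A n `<=` E n &
        P n (A n) @[n --> \oo] --> 1%E].

End Probability.

(* Main.v *)
Require Import Defs.
From HB Require Import structures.
From mathcomp Require Import all_boot all_order all_algebra.
From mathcomp Require Import all_classical all_reals all_analysis.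
From mathcomp Require Import measurable_realfun ring lra.

(** The optimality of [xhat] against the feasible point [xstar] gives the usual
    Lasso cone inequality as soon as every correlation between a column of the
    unsaturated design and the quantization errors is at most 3/4 of
    [lambda * Delta]. Since errors bounded by [Delta / 2] satisfy Hoeffding's
    bound with room to spare at this level, this fails with probability at most
    [1 / N], although [lambda] itself is only tuned to a fixed confidence.

    The restricted eigenvalue inequality must hold uniformly over all sets of
    rows of density at least [1 - tau], because the saturation pattern depends on
    the design. Maurey's empirical method approximates a vector of the cone,
    simultaneously in [l2] norm and after applying the design, by a multiple of a
    sum of O(S) signed basis vectors. There are only [(2N)^O(S) = exp(o(M))] such
    sums, so it suffices to treat a single vector [v], for which one shows that
    all but few rows have [<Phi_i, v>^2 >= c |v|^2].

    The number of rows with a small form is controlled by the product over the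
    rows of a nonnegative function of [<Phi_i, v>] which is large near 0 and is a
    finite linear combination of exponentials. Such a product expands into
    exponentials of linear forms in the entries of [Phi], whose expectations
    follow from the moment generating function of a single entry; neither the
    joint law of the entries nor the law of [<Phi_i, v>] is needed. *)

Set Implicit Arguments.
Unset Strict Implicit.
Unset Printing Implicit Defensive.

Import Order.TTheory GRing.Theory Num.Theory numFieldNormedType.Exports.

Local Open Scope classical_set_scope.
Local Open Scope ring_scope.

(** * Maurey's empirical method *)

Section Maurey.
Variable R : realType.

Lemma weighted_exists_le (I : finType) (p a : I -> R) (b : R) :
  (forall i, 0 <= p i) -> \sum_i p i = 1 -> \sum_i p i * a i <= b ->
  exists i, a i <= b.
Proof.
move=> p0 p1 pab; apply: contrapT => /forallNP ab.
have lt_ab i : b < a i by rewrite ltNge; apply/negP/ab.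
suff : b < \sum_i p i * a i by rewrite ltNge pab.
have -> : b = \sum_i p i * b by rewrite -mulr_suml p1 mul1r.
have [i pi0] : exists i, 0 < p i.
  apply: contrapT => /forallNP h; have : \sum_i p i = 0.
    by apply: big1 => i _; apply/eqP; move/negP: (h i); rewrite lt0r p0 andbT negbK.
  by rewrite p1; apply/eqP; rewrite oner_eq0.
rewrite (bigD1 i)//= [ltRHS](bigD1 i)//= ltr_leD ?ltr_pM2l//.
by apply: ler_sum => j _; rewrite ler_wpM2l// ltW.
Qed.

(* The empirical method of Maurey, derandomized: each new atom is chosen so that
   the weighted square of the accumulated error grows at most by [K]. *)
Lemma maurey (I D : finType) (c : D -> R) (u : I -> D -> R) (p : I -> R)
    (x : D -> R) (K : R) (m : nat) :
  (forall d, 0 <= c d) -> (forall i, 0 <= p i) -> \sum_i p i = 1 ->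
  (forall d, x d = \sum_i p i * u i d) ->
  (forall i, \sum_d c d * u i d ^+ 2 <= K) ->
  exists t : m.-tuple I,
    \sum_d c d * (m%:R * x d - \sum_(i <- t) u i d) ^+ 2 <= m%:R * K.
Proof.
move=> c0 p0 p1 xE uK; elim: m => [|m [t IH]].
  exists [tuple]; rewrite mul0r big1// => d _.
  by rewrite big_nil mul0r subr0 expr0n mulr0.
pose r d := m%:R * x d - \sum_(i <- t) u i d.
(* If [i] is drawn with law [p], the new error [r d + x d - u i d] has mean [r d] and mean square
   [r d ^+ 2 - x d ^+ 2] plus the mean of [u i d ^+ 2]. Some [i] does at least as well as the
   average. *)
have [|i hi] := @weighted_exists_le I p
    (fun i => \sum_d c d * (r d + x d - u i d) ^+ 2)
    (\sum_d c d * r d ^+ 2 + K) p0 p1.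
  apply: (@le_trans _ _ (\sum_d c d * r d ^+ 2 +
      \sum_i p i * \sum_d c d * u i d ^+ 2)); last first.
    rewrite lerD2l -[leRHS]mul1r -p1 mulr_suml.
    by apply: ler_sum => i _; rewrite ler_wpM2l.
  under eq_bigr do rewrite mulr_sumr.
  under [X in _ + X]eq_bigr do rewrite mulr_sumr.
  rewrite exchange_big/= [X in _ + X]exchange_big/= -big_split/=.
  apply: ler_sum => d _.
  have -> : \sum_i p i * (c d * (r d + x d - u i d) ^+ 2) =
      c d * ((r d + x d) ^+ 2 * (\sum_i p i)
      - 2 * (r d + x d) * (\sum_i p i * u i d)
      + \sum_i p i * u i d ^+ 2).
    rewrite !mulr_sumr -sumrB -big_split/= mulr_sumr.
    by apply: eq_bigr => i _; ring.
  rewrite p1 -xE.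
  have -> : \sum_i p i * (c d * u i d ^+ 2) = c d * \sum_i p i * u i d ^+ 2.
    by rewrite mulr_sumr; apply: eq_bigr => i _; ring.
  rewrite -mulrDr ler_wpM2l// lerD2r mulr1.
  by rewrite -subr_ge0; have := sqr_ge0 (x d); lra.
exists [tuple of i :: t].
rewrite (eq_bigr (fun d => c d * (r d + x d - u i d) ^+ 2)); last first.
  move=> d _; congr (_ * _ ^+ 2).
  by rewrite /r big_cons -natr1; ring.
apply: (le_trans hi); rewrite -natr1 mulrDl mul1r lerD2r; exact: IH.
Qed.

End Maurey.

(** * Restricted eigenvalues: from atom sums to the cone *)

Section RestrictedEigenvalue.
Variable R : realType.

(** Unnormalized Maurey approximants; the boolean of an atom is its sign, with [true] standing for
    minus. *)
Definition atom_sum N m (t : m.-tuple ('I_N * bool)) : 'cV[R]_N :=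
  \col_j \sum_(a <- t) (-1) ^+ a.2 * (a.1 == j)%:R.

Lemma cV_sqr_sum_gt0 N (v : 'cV[R]_N) : v != 0 -> 0 < \sum_j v j 0 ^+ 2.
Proof.
move=> v0; rewrite lt0r sumr_ge0 ?andbT; last by move=> j _; exact: sqr_ge0.
apply: contra v0 => /eqP /psumr_eq0P h; apply/eqP/matrixP => j k.
rewrite ord1 [RHS]mxE; apply/eqP; rewrite -sqrf_eq0; apply/eqP; apply: h => //.
by move=> i _; exact: sqr_ge0.
Qed.

Lemma mulmx_atom_sum M N m (A : 'M[R]_(M, N)) (t : m.-tuple ('I_N * bool)) i :
  (A *m atom_sum t) i 0 = \sum_(a <- t) (-1) ^+ a.2 * A i a.1.
Proof.
rewrite mxE; under eq_bigr do rewrite mxE mulr_sumr.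
rewrite exchange_big/=; apply: eq_bigr => a _.
rewrite (bigD1 a.1)//= eqxx mulr1 big1 ?addr0 1?mulrC// => j ja.
by rewrite eq_sym (negbTE ja) !mulr0.
Qed.

(** Equivalent to [b ^+ 2 <= 2 * a ^+ 2 + 2 * (b - a) ^+ 2]: a lower bound passes from a vector to a
    nearby one at the cost of a factor 2. *)
Lemma sqr_half_le (a b : R) : 2^-1 * b ^+ 2 - (b - a) ^+ 2 <= a ^+ 2.
Proof. by have := sqr_ge0 (2 * a - b); rewrite !expr2; lra. Qed.

(** With [l] the l1 norm of [x], the vector [x] is the average, with weights [|x j| / l], of the
    basis vectors multiplied by [l] and the sign of [x j]. Maurey's method applied jointly to [x]
    and [A *m x] gives an atom sum close to [m / l] times [x], and with a close image. The lower
    bound for atom sums then carries over, up to the factor 8. *)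
Lemma restricted_eigenvalue M N m (A : 'M[R]_(M, N)) (I : {set 'I_M})
    (kappa C S : R) (x : 'cV[R]_N) :
  0 < kappa <= 1 -> 0 < C -> 0 <= S -> (0 < M)%N -> (0 < m)%N ->
  (forall j, \sum_i A i j ^+ 2 <= C * M%:R) ->
  (forall t : m.-tuple ('I_N * bool),
     kappa * M%:R * \sum_j atom_sum t j 0 ^+ 2 <=
     \sum_(i in I) (A *m atom_sum t) i 0 ^+ 2) ->
  (\sum_j `|x j 0|) ^+ 2 <= 64 * S * \sum_j x j 0 ^+ 2 ->
  1024 * (C + 1) * S <= kappa * m%:R ->
  kappa / 8 * M%:R * \sum_j x j 0 ^+ 2 <= \sum_(i in I) (A *m x) i 0 ^+ 2.
Proof.
move=> /andP[k0 k1] C0 S0 M0 m0 hcol hatom hx hm.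
set l : R := \sum_j `|x j 0| in hx *.
set X := \sum_j x j 0 ^+ 2 in hx *.
have X0 : 0 <= X by apply: sumr_ge0 => j _; exact: sqr_ge0.
have l0 : 0 <= l by apply: sumr_ge0.
have [l00|lN0] := eqVneq l 0.
  have xj j : x j 0 = 0.
    apply/eqP; rewrite -normr_eq0; apply/eqP.
    by move/psumr_eq0P : l00 => ->.
  have -> : X = 0 by apply: big1 => j _; rewrite xj expr0n.
  by rewrite mulr0; apply: sumr_ge0 => i _; exact: sqr_ge0.
have M0' : 0 < M%:R :> R by rewrite ltr0n.
have m0' : 0 < m%:R :> R by rewrite ltr0n.
(* The coordinates [inl] hold the vector and [inr] its image. The weight of the image is such that,
   by the bound on the columns, each part of an atom contributes at most [l ^+ 2]. *)
pose c (d : 'I_N + 'I_M) : R := if d is inr _ then (C * M%:R)^-1 else 1.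
pose sgn j : R := (-1) ^+ (x j 0 < 0)%R.
pose u (j : 'I_N) (d : 'I_N + 'I_M) : R :=
  l * (sgn j * match d with inl k => (j == k)%:R | inr i => A i j end).
pose y (d : 'I_N + 'I_M) : R :=
  match d with inl k => x k 0 | inr i => (A *m x) i 0 end.
have CM0 : 0 < C * M%:R by exact: mulr_gt0.
have c0 d : 0 <= c d.
  by case: d => //= _; rewrite invr_ge0 ltW.
have pu j z : `|x j 0| / l * (l * (sgn j * z)) = x j 0 * z.
  have lV : l^-1 * l = 1 by rewrite mulVf.
  rewrite -[RHS](congr1 (fun v => v * z) (esym (realEsign (num_real (x j 0))))).
  rewrite -/(sgn j); move: (sgn j) `|x j 0| => a b.
  by rewrite -[RHS]mulr1 -lV; ring.
have sgn2 j : sgn j ^+ 2 = 1 by rewrite /sgn sqrr_sign.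
have [||||t ht] := @maurey R _ _ c u (fun j => `|x j 0| / l) y (2 * l ^+ 2) m c0.
- by move=> j; rewrite divr_ge0.
- by rewrite -mulr_suml divff.
- case=> [k|i] /=; rewrite /u/=.
    rewrite (bigD1 k)//= pu eqxx mulr1 big1 ?addr0// => j jk.
    by rewrite pu (negbTE jk) mulr0.
  by rewrite mxE; apply: eq_bigr => j _; rewrite pu mulrC.
- move=> j; rewrite big_sumType/=.
  have -> : 2 * l ^+ 2 = l ^+ 2 + l ^+ 2 by ring.
  apply: lerD.
    rewrite (bigD1 j)//= big1 ?addr0 /u.
      by rewrite eqxx mulr1 mul1r exprMn sgn2 mulr1.
    by move=> k kj; rewrite eq_sym (negbTE kj) !mulr0 expr0n mulr0.
  under eq_bigr do rewrite /u exprMn exprMn sgn2 mul1r mulrCA.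
  rewrite -mulr_sumr -[leRHS]mulr1 ler_wpM2l ?sqr_ge0//.
  by rewrite -mulr_sumr mulrC ler_pdivrMr ?mul1r//; exact: hcol.
pose T := [tuple of [seq (j, x j 0 < 0) | j <- t]].
have uE d : \sum_(j <- t) u j d = l * match d with
   | inl k => atom_sum T k 0 | inr i => (A *m atom_sum T) i 0 end.
  rewrite /u -mulr_sumr; congr (_ * _).
  by case: d => [k|i]; rewrite ?mulmx_atom_sum ?mxE big_map.
rewrite (eq_bigr _ (fun d _ => congr1 (fun z => c d * (m%:R * y d - z) ^+ 2) (uE d))) in ht.
rewrite big_sumType/= in ht.
pose E1 := \sum_j (m%:R * x j 0 - l * atom_sum T j 0) ^+ 2.
pose E2 := \sum_i (m%:R * (A *m x) i 0 - l * (A *m atom_sum T) i 0) ^+ 2.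
have {}ht : E1 + (C * M%:R)^-1 * E2 <= m%:R * (2 * l ^+ 2).
  rewrite /E2 mulr_sumr; apply: le_trans ht; rewrite lerD2r.
  by apply: ler_sum => j _; rewrite mul1r.
have E10 : 0 <= E1 by apply: sumr_ge0 => j _; exact: sqr_ge0.
have E20 : 0 <= E2 by apply: sumr_ge0 => j _; exact: sqr_ge0.
have e1 : E1 <= 2 * m%:R * l ^+ 2.
  apply: le_trans (_ : m%:R * (2 * l ^+ 2) <= _); last by rewrite mulrCA mulrA.
  by apply: le_trans ht; rewrite lerDl mulr_ge0// invr_ge0 ltW.
have e2 : E2 <= 2 * C * M%:R * m%:R * l ^+ 2.
  apply: (@le_trans _ _ (C * M%:R * (m%:R * (2 * l ^+ 2)))); last first.
    by rewrite le_eqVlt; apply/orP; left; apply/eqP; ring.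
  by rewrite -ler_pdivrMl//; apply: le_trans ht; rewrite lerDr.
have f1 : 2^-1 * m%:R ^+ 2 * X - 2 * m%:R * l ^+ 2 <=
    l ^+ 2 * \sum_j atom_sum T j 0 ^+ 2.
  apply: (@le_trans _ _ (2^-1 * m%:R ^+ 2 * X - E1)); first by rewrite lerB.
  rewrite !mulr_sumr -sumrB; apply: ler_sum => j _.
  by rewrite -mulrA -!exprMn; exact: sqr_half_le.
have f2 : 2^-1 * (l ^+ 2 * \sum_(i in I) (A *m atom_sum T) i 0 ^+ 2)
    - 2 * C * M%:R * m%:R * l ^+ 2 <= m%:R ^+ 2 * \sum_(i in I) (A *m x) i 0 ^+ 2.
  apply: (@le_trans _ _ (2^-1 * (l ^+ 2 * \sum_(i in I) (A *m atom_sum T) i 0 ^+ 2)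
     - \sum_(i in I) (m%:R * (A *m x) i 0 - l * (A *m atom_sum T) i 0) ^+ 2)).
    rewrite lerB//; apply: le_trans e2; rewrite /E2 [leRHS](bigID (mem I))/= lerDl.
    by apply: sumr_ge0 => i _; exact: sqr_ge0.
  rewrite !mulr_sumr -sumrB; apply: ler_sum => i _.
  rewrite -!exprMn -(sqrrN (m%:R * _ - _)) opprB; exact: sqr_half_le.
have f3 := hatom T.
set W := \sum_j atom_sum T j 0 ^+ 2 in f1 f3 *.
set V := \sum_(i in I) (A *m atom_sum T) i 0 ^+ 2 in f2 f3 *.
set Y := \sum_(i in I) (A *m x) i 0 ^+ 2 in f2 *.
rewrite -(ler_pM2l (exprn_gt0 2 m0')); apply: le_trans f2.
have f3' : kappa * M%:R * (2^-1 * m%:R ^+ 2 * X - 2 * m%:R * l ^+ 2) <= l ^+ 2 * V.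
  apply: le_trans (_ : kappa * M%:R * (l ^+ 2 * W) <= _).
    by rewrite ler_wpM2l// mulr_ge0// ltW.
  by rewrite mulrCA ler_wpM2l// sqr_ge0.
(* After division by [m%:R * M%:R], the two halvings leave [kappa * m%:R * X / 4], and the
   approximation errors may use up half of it. Given [l ^+ 2 <= 64 * S * X] and [kappa <= 1], the
   constant 1024 ensures this. *)
have kC : (kappa + 2 * C) * l ^+ 2 <= kappa * m%:R * X / 8.
  apply: (@le_trans _ _ ((kappa + 2 * C) * (64 * S * X))).
    by rewrite ler_wpM2l//; lra.
  have : 1024 * (C + 1) * S * X <= kappa * m%:R * X by rewrite ler_wpM2r.
  have SX0 : 0 <= S * X by exact: mulr_ge0.
  have : kappa * (S * X) <= S * X by rewrite -[leRHS]mul1r ler_wpM2r.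
  by lra.
have : m%:R * M%:R * ((kappa + 2 * C) * l ^+ 2) <= m%:R * M%:R * (kappa * m%:R * X / 8).
  by rewrite ler_wpM2l// mulr_ge0// ltW.
by move: f3'; rewrite !expr2; lra.
Qed.

End RestrictedEigenvalue.

(** * Deterministic analysis of the Lasso *)

Section Lasso.
Variable R : realType.

(** Cauchy-Schwarz against the constant 1, derived from the nonnegativity of the squared deviations
    from the mean. *)
Lemma sqr_sum_le_card (I : finType) (T : {set I}) (a : I -> R) :
  (\sum_(i in T) a i) ^+ 2 <= #|T|%:R * \sum_(i in T) a i ^+ 2.
Proof.
have [->|T0] := eqVneq T finset.set0; first by rewrite !finset.big_set0 expr0n mulr0.
have c0 : 0 < #|T|%:R :> R by rewrite ltr0n card_gt0.
set s := \sum_(i in T) a i; pose t := s / #|T|%:R.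
have : 0 <= \sum_(i in T) (a i - t) ^+ 2 by apply: sumr_ge0 => i _; exact: sqr_ge0.
have -> : \sum_(i in T) (a i - t) ^+ 2 =
    \sum_(i in T) a i ^+ 2 - 2 * t * s + t ^+ 2 * #|T|%:R.
  rewrite /s mulr_sumr -sumrB -sum1_card natr_sum mulr_sumr -big_split/=.
  by apply: eq_bigr => i _; ring.
have -> : 2 * t * s = 2 * (s ^+ 2 / #|T|%:R) by rewrite /t; field; rewrite gt_eqF.
have -> : t ^+ 2 * #|T|%:R = s ^+ 2 / #|T|%:R by rewrite /t; field; rewrite gt_eqF.
move=> h; rewrite mulrC -ler_pdivrMr//; lra.
Qed.

(** Expanding the squares around [xs] leaves a cross term of at least [- (3 / 4 * lam * l1norm h)],
    while the penalties differ by at most [lam * (s - s')], where [s'] is the l1 mass of [h] off the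
    support. So half the quadratic term is at most [7 / 4 * lam * s - lam * s' / 4], which yields
    both conclusions. *)
Lemma lasso_basic_inequality M N (A : 'M[R]_(M, N)) (y : 'cV[R]_M)
    (I : {set 'I_M}) (xs xh : 'cV[R]_N) (lam : R) :
  let e := A *m xs - y in
  let h := xh - xs in
  let s := \sum_(j | xs j 0 != 0) `|h j 0| in
  0 < lam ->
  (forall j, `|\sum_(i in I) A i j * e i 0| <= 3 / 4 * lam) ->
  2^-1 * \sum_(i in I) (A *m xh - y) i 0 ^+ 2 + lam * l1norm xh <=
  2^-1 * \sum_(i in I) e i 0 ^+ 2 + lam * l1norm xs ->
  l1norm h <= 8 * s /\ \sum_(i in I) (A *m h) i 0 ^+ 2 <= 4 * lam * s.
Proof.
move=> e h s lam0 He Hopt.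
pose s' := \sum_(j | ~~ (xs j 0 != 0)) `|h j 0|.
have s0 : 0 <= s by apply: sumr_ge0.
have s'0 : 0 <= s' by apply: sumr_ge0.
have hE : l1norm h = s + s' by rewrite /l1norm (bigID (fun j => xs j 0 != 0)).
have resE : \sum_(i in I) (A *m xh - y) i 0 ^+ 2 =
    \sum_(i in I) (A *m h) i 0 ^+ 2
    + 2 * \sum_(i in I) (A *m h) i 0 * e i 0 + \sum_(i in I) e i 0 ^+ 2.
  rewrite mulr_sumr -!big_split/=; apply: eq_bigr => i _.
  have -> : (A *m xh - y) i 0 = (A *m h) i 0 + e i 0.
    by rewrite /e /h mulmxBr !mxE; ring.
  by ring.
have cross : - (3 / 4 * lam * l1norm h) <= \sum_(i in I) (A *m h) i 0 * e i 0.
  have -> : \sum_(i in I) (A *m h) i 0 * e i 0 =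
      \sum_j h j 0 * \sum_(i in I) A i j * e i 0.
    under eq_bigr do rewrite mxE mulr_suml.
    rewrite exchange_big/=; apply: eq_bigr => j _; rewrite mulr_sumr.
    by apply: eq_bigr => i _; ring.
  rewrite /l1norm mulr_sumr -sumrN; apply: ler_sum => j _.
  rewrite lerNl; apply: le_trans (ler_norm _) _.
  by rewrite normrN normrM mulrC ler_wpM2r.
have l1 : l1norm xs - l1norm xh <= s - s'.
  rewrite /l1norm -sumrB (bigID (fun j => xs j 0 != 0))/=; apply: lerD.
    apply: ler_sum => j _; rewrite /h lerBlDr.
    have -> : xs j 0 = xh j 0 - (xh - xs) j 0 by rewrite !mxE; ring.
    by apply: le_trans (ler_normB _ _) _; rewrite addrC.
  rewrite /s' -sumrN; apply: ler_sum => j; rewrite negbK => /eqP x0.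
  by rewrite x0 normr0 sub0r /h !mxE x0 subr0.
rewrite resE in Hopt.
have l1' : lam * (l1norm xs - l1norm xh) <= lam * (s - s') by rewrite ler_pM2l.
set Q := \sum_(i in I) (A *m h) i 0 ^+ 2 in Hopt *.
have Q0 : 0 <= Q by apply: sumr_ge0 => i _; exact: sqr_ge0.
have key : 2^-1 * Q <= 7 / 4 * (lam * s) - 4^-1 * (lam * s').
  by move: cross Hopt l1'; rewrite hE; lra.
have ls' : 0 <= lam * s' by rewrite mulr_ge0// ltW.
have ls : 0 <= lam * s by rewrite mulr_ge0// ltW.
split; last by rewrite -mulrA; lra.
rewrite hE; have : lam * s' <= lam * (7 * s) by lra.
by rewrite ler_pM2l//; lra.
Qed.

(** Let [X] be the squared norm of [h] and [S] the sparsity. The cone inequality and Cauchy-Schwarz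
    on the support give [l1norm h ^+ 2 <= 64 * S * X], so the eigenvalue hypothesis applies:
    [k * X <= 4 * lam * s], where [s ^+ 2 <= S * X]. For an empty support the first inequality
    already forces [h = 0]. *)
Lemma lasso_l2_bound M N (A : 'M[R]_(M, N)) (y : 'cV[R]_M)
    (I : {set 'I_M}) (xs xh : 'cV[R]_N) (lam k : R) :
  let e := A *m xs - y in
  let h := xh - xs in
  0 < lam -> 0 < k ->
  (forall j, `|\sum_(i in I) A i j * e i 0| <= 3 / 4 * lam) ->
  2^-1 * \sum_(i in I) (A *m xh - y) i 0 ^+ 2 + lam * l1norm xh <=
  2^-1 * \sum_(i in I) e i 0 ^+ 2 + lam * l1norm xs ->
  ((0 < nnz xs)%N -> forall v : 'cV[R]_N,
     (\sum_j `|v j 0|) ^+ 2 <= 64 * (nnz xs)%:R * \sum_j v j 0 ^+ 2 ->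
     k * \sum_j v j 0 ^+ 2 <= \sum_(i in I) (A *m v) i 0 ^+ 2) ->
  l2norm h <= 4 * lam * Num.sqrt (nnz xs)%:R / k.
Proof.
move=> e h lam0 k0 He Hopt RE.
have [cone quad] := lasso_basic_inequality lam0 He Hopt.
rewrite -/h in cone quad; set s := \sum_(j | _) _ in cone quad.
set X := \sum_j h j 0 ^+ 2.
have s0 : 0 <= s by apply: sumr_ge0.
have sS : s ^+ 2 <= (nnz xs)%:R * X.
  rewrite /s (eq_bigl (mem [set j | xs j 0 != 0]%SET)); last by move=> j; rewrite !inE.
  apply: le_trans (sqr_sum_le_card _ _) _; rewrite ler_wpM2l//.
  rewrite /X [leRHS](bigID (mem [set j | xs j 0 != 0]%SET))/=.
  under eq_bigr do rewrite real_normK ?num_real//.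
  by rewrite lerDl; apply: sumr_ge0 => j _; exact: sqr_ge0.
have X0 : 0 <= X by apply: sumr_ge0 => j _; exact: sqr_ge0.
have l0 : 0 <= l1norm h by apply: sumr_ge0.
have hS : l1norm h ^+ 2 <= 64 * (nnz xs)%:R * X.
  apply: (@le_trans _ _ ((8 * s) ^+ 2)); first by rewrite ler_sqr ?nnegrE// mulr_ge0.
  by rewrite exprMn -mulrA; apply: ler_pM; rewrite ?sqr_ge0// !expr2 -natrM.
have [S0|S0] := posnP (nnz xs).
  have hj j : h j 0 = 0.
    apply/eqP; rewrite -normr_eq0; apply/eqP.
    have : l1norm h = 0.
      by apply/eqP; rewrite -sqrf_eq0 eq_le sqr_ge0 andbT (le_trans hS)// S0 mulr0 mul0r.
    by move=> /psumr_eq0P ->.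
  rewrite S0 sqrtr0 mulr0 mul0r /l2norm big1 ?sqrtr0// => j _.
  by rewrite hj expr0n.
have kX : k * X <= 4 * lam * s by apply: le_trans quad; exact: RE.
have lk : 0 <= 4 * lam / k by rewrite divr_ge0 ?mulr_ge0// ltW.
have sX : X <= (4 * lam / k) * s by rewrite mulrAC ler_pdivlMr// mulrC.
have -> : 4 * lam * Num.sqrt (nnz xs)%:R / k = Num.sqrt ((4 * lam / k) ^+ 2 * (nnz xs)%:R).
  by rewrite sqrtrM ?sqr_ge0// sqrtr_sqr ger0_norm// mulrAC.
rewrite /l2norm -/X ler_wsqrtr//.
have [->|XN0] := eqVneq X 0; first by rewrite mulr_ge0// sqr_ge0.
have Xp : 0 < X by rewrite lt0r XN0.
rewrite -(ler_pM2r Xp) -expr2.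
apply: (@le_trans _ _ ((4 * lam / k * s) ^+ 2)).
  by rewrite ler_sqr ?nnegrE// mulr_ge0.
rewrite [leLHS]exprMn -[leRHS]mulrA ler_wpM2l//; exact: sqr_ge0.
Qed.

End Lasso.

(** * Integrals determined by weighted laws *)

Section WeightedLaw.
Variable R : realType.
Import HBNNSimple.

Lemma integral_weighted_nnsfun d (T : measurableType d)
    (mu : {measure set T -> \bar R}) (G X : T -> R) (h : {nnsfun R >-> R}) :
  measurable_fun setT G -> (forall w, 0 <= G w) -> measurable_fun setT X ->
  (\int[mu]_w (G w * h (X w))%:E =
   \sum_(r \in range h) r%:E * \int[mu]_w (G w * \1_(h @^-1` [set r]) (X w))%:E)%E.
Proof.
move=> mG G0 mX.
have mI r : measurable_fun setT (fun w => G w * \1_(h @^-1` [set r]) (X w)).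
  apply: measurable_funM => //.
  by apply: (measurableT_comp _ mX); exact: measurable_indic.
have I0 r w : 0 <= G w * \1_(h @^-1` [set r]) (X w).
  by rewrite mulr_ge0.
under eq_integral => w _.
  rewrite [h (X w)]fimfunE mulrC mulr_fsuml//.
  under eq_fsbigr do rewrite -mulrA (mulrC _ (G w)).
  rewrite -fsumEFin//. over.
have rI0 r w : 0 <= r * (G w * \1_(h @^-1` [set r]) (X w)).
  have [[y hy]|/= nr] := pselect (exists y, h y = r).
    by rewrite mulr_ge0// -hy.
  rewrite indicE memNset ?mulr0// => /= hr; apply: nr; by exists (X w).
rewrite /= ge0_integral_fsum//; last 2 first.
- by move=> r; apply/measurable_EFinP; exact: measurable_funM.
- by move=> r w _; rewrite lee_fin.
apply: eq_fsbigr => r; rewrite inE /= => -[y _ hy].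
under eq_integral do rewrite EFinM.
rewrite ge0_integralZl//.
- by apply/measurable_EFinP.
- by move=> w _; rewrite lee_fin.
- by rewrite lee_fin -hy.
Qed.

(** Equality on indicators passes to simple functions, then to [f] by monotone convergence. The
    weight serves twice: as the product of the other factors under independence, and as a
    density. *)
Lemma eq_integral_weighted d1 (T1 : measurableType d1) d2 (T2 : measurableType d2)
    (mu1 : {measure set T1 -> \bar R}) (mu2 : {measure set T2 -> \bar R})
    (G1 X1 : T1 -> R) (G2 X2 : T2 -> R) (f : R -> R) :
  measurable_fun setT G1 -> (forall w, 0 <= G1 w) -> measurable_fun setT X1 ->
  measurable_fun setT G2 -> (forall w, 0 <= G2 w) -> measurable_fun setT X2 ->
  (forall B : set R, measurable B ->
    (\int[mu1]_w (G1 w * \1_B (X1 w))%:E = \int[mu2]_w (G2 w * \1_B (X2 w))%:E)%E) ->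
  measurable_fun setT f -> (forall x, 0 <= f x) ->
  (\int[mu1]_w (G1 w * f (X1 w))%:E = \int[mu2]_w (G2 w * f (X2 w))%:E)%E.
Proof.
move=> mG1 G10 mX1 mG2 G20 mX2 eqB mf f0.
have mEf : measurable_fun setT (EFin \o f) by exact/measurable_EFinP.
pose h := nnsfun_approx measurableT mEf.
have lim d (T : measurableType d) (mu : {measure set T -> \bar R}) (G X : T -> R) :
    measurable_fun setT G -> (forall w, 0 <= G w) -> measurable_fun setT X ->
    (\int[mu]_w (G w * h n (X w))%:E)%E @[n --> \oo] -->
    (\int[mu]_w (G w * f (X w))%:E)%E.
  move=> mG G0 mX.
  have -> : (fun w => (G w * f (X w))%:E) =
      (fun w => limn (fun n => (G w * h n (X w))%:E)).
    apply/funext => w; apply/esym/cvg_lim => //.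
    under eq_fun do rewrite EFinM.
    rewrite EFinM; apply: cvgeZl => //.
    by apply: (cvg_nnsfun_approx measurableT mEf) => // x _; rewrite lee_fin.
  apply: (@cvg_monotone_convergence _ _ _ mu setT measurableT
    (fun n w => (G w * h n (X w))%:E)).
  - move=> n; apply/measurable_EFinP/measurable_funM => //.
    exact: (measurableT_comp _ mX).
  - by move=> n w _; rewrite lee_fin mulr_ge0.
  - move=> w _ a b ab; rewrite lee_fin ler_wpM2l//.
    by have /lefP := nd_nnsfun_approx measurableT mEf ab; exact.
have e n : (\int[mu1]_w (G1 w * h n (X1 w))%:E = \int[mu2]_w (G2 w * h n (X2 w))%:E)%E.
  rewrite !integral_weighted_nnsfun//; apply: eq_fsbigr => r _.
  by rewrite eqB.
have l1 := lim _ _ mu1 _ _ mG1 G10 mX1.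
have l2 := lim _ _ mu2 _ _ mG2 G20 mX2.
move: l1; under eq_fun do rewrite e.
by move=> l1; exact: (cvg_unique _ l1 l2).
Qed.

End WeightedLaw.

(** * Products of functions of independent variables *)

Section Independence.
Context (R : realType) d (T : measurableType d) (P : probability T R).
Variables (I : finType) (J : {set I}) (X : I -> T -> R).
Hypothesis mX : forall i, measurable_fun setT (X i).
Hypothesis indepX : mutually_independent P J X.

(* The functions [f i] replace the indicators of the definition of independence
   one index at a time, along the list [s]. *)
Lemma integral_prod_independent_aux (f : I -> R -> R) (m : I -> R)
    (K : {set I}) (s : seq I) (E : I -> set R) :
  (forall i, measurable_fun setT (f i)) -> (forall i x, 0 <= f i x) ->
  (forall i, i \in K -> (\int[P]_w (f i (X i w))%:E = (m i)%:E)%E) ->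
  K \subset J -> (forall i, measurable (E i)) ->
  (\int[P]_w (\prod_(i in K)
     (if i \in s then f i (X i w) else \1_(E i) (X i w)))%:E =
   (\prod_(i in K) (if i \in s then m i else fine (P (X i @^-1` E i))))%:E)%E.
Proof.
move=> mf f0 fm KJ.
have mXE i B : measurable B -> measurable (X i @^-1` B).
  by move=> mB; rewrite -[_ @^-1` _]setTI; exact: mX.
elim: s E => [|k s IH] E mE.
  transitivity (\int[P]_w (\1_(\bigcap_(i in [set` K]) X i @^-1` E i) w)%:E)%E.
    apply: eq_integral => w _; congr EFin.
    have [wK|wK] := pselect ((\bigcap_(i in [set` K]) X i @^-1` E i) w).
      rewrite [RHS]indicE mem_set// big1// => i iK.
      by rewrite indicE mem_set//; exact: wK.
    rewrite [RHS]indicE memNset//.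
    have [i iK nE] : exists2 i, i \in K & ~ E i (X i w).
      apply: contrapT => /forall2NP h; apply: wK => i /= iK.
      by have [//|/contrapT] := h i.
    by rewrite (bigD1 i)//= indicE memNset// mul0r.
  rewrite integral_indic// ?setIT.
    etransitivity; first exact: (indepX KJ mE).
    rewrite -prodEFin; apply: eq_bigr => i _.
    by rewrite fineK// fin_num_measure//; exact: mXE.
  by apply: fin_bigcap_measurable => // i _; exact: mXE.
have [ks|ks] := boolP (k \in s).
  have ins i : (i \in k :: s) = (i \in s).
    by rewrite inE; case: eqP => [->|].
  under eq_integral do under eq_bigr do rewrite ins.
  under [in RHS]eq_bigr do rewrite ins.
  exact: IH.
have [kK|kK] := boolP (k \in K); last first.
  have ins i : i \in K -> (i \in k :: s) = (i \in s).
    by move=> iK; rewrite inE; case: eqP => // ik; rewrite ik (negbTE kK) in iK.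
  under eq_integral do under eq_bigr => i iK do rewrite ins//.
  under [in RHS]eq_bigr => i iK do rewrite ins//.
  exact: IH.
pose F i w := if i \in s then f i (X i w) else \1_(E i) (X i w).
pose c i := if i \in s then m i else fine (P (X i @^-1` E i)).
have F0 i w : 0 <= F i w by rewrite /F; case: ifP.
have mF i : measurable_fun setT (F i).
  rewrite /F; case: (i \in s); first exact: (measurableT_comp (mf i) (mX i)).
  by apply: (measurableT_comp _ (mX i)); exact: measurable_indic.
have c0 i : i \in K -> 0 <= c i.
  move=> iK; rewrite /c; case: ifP => _; last exact: fine_ge0.
  by rewrite -lee_fin -fm//; apply: integral_ge0 => w _; rewrite lee_fin.
have ne i : i != k -> (i \in k :: s) = (i \in s).
  by rewrite inE => /negbTE ->.
transitivity (\int[P]_w ((\prod_(i in K | i != k) F i w) * f k (X k w))%:E)%E.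
  apply: eq_integral => w _; rewrite (bigD1 k)//= inE eqxx/= mulrC; congr (_ * _)%:E.
  by apply: eq_bigr => i /andP[_ ik]; rewrite ne.
transitivity (\int[P]_w ((\prod_(i in K | i != k) c i) * f k (X k w))%:E)%E.
  apply: eq_integral_weighted => //.
  - by under eq_fun do rewrite -big_filter; apply: measurable_prod.
  - by move=> w; apply: prodr_ge0.
  - by move=> w; apply: prodr_ge0 => i /andP[iK _]; exact: c0.
  move=> B mB.
  (* With [B] at [k] and the other sets kept, the induction hypothesis gives the identity for the
     indicator of an arbitrary [B], weighted by the remaining factors. *)
  pose E' i := if i == k then B else E i.
  have mE' i : measurable (E' i) by rewrite /E'; case: ifP.
  transitivity (\int[P]_w (\prod_(i in K)
     (if i \in s then f i (X i w) else \1_(E' i) (X i w)))%:E)%E.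
    apply: eq_integral => w _; rewrite [in RHS](bigD1 k)//= (negbTE ks) mulrC.
    congr (_ * _)%:E; first by rewrite /E' eqxx.
    by apply: eq_bigr => i /andP[_ ik]; rewrite /E' (negbTE ik).
  rewrite IH// (bigD1 k)//= (negbTE ks) /E' eqxx.
  under [in RHS]eq_integral do rewrite EFinM.
  rewrite ge0_integralZl//.
  - rewrite mulrC EFinM; congr (_ * _)%E.
      by congr EFin; apply: eq_bigr => i /andP[_ ik]; rewrite (negbTE ik).
    have -> : (fun w => (\1_B (X k w))%:E) = (fun w => (\1_(X k @^-1` B) w)%:E : \bar R).
      by [].
    rewrite integral_indic ?setIT//; last exact: mXE.
    by rewrite fineK// fin_num_measure//; exact: mXE.
  - apply/measurable_EFinP; apply: (measurableT_comp _ (mX k)).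
    exact: measurable_indic.
  - by rewrite lee_fin; apply: prodr_ge0 => i /andP[iK _]; exact: c0.
under eq_integral do rewrite EFinM.
rewrite ge0_integralZl//.
- rewrite fm// -EFinM [in RHS](bigD1 k)//= ?inE eqxx/= [in RHS]mulrC; congr (_ * _)%:E.
  by apply: eq_bigr => i /andP[_ ik]; rewrite ne.
- by apply/measurable_EFinP; exact: (measurableT_comp _ (mX k)).
- by move=> w _; rewrite lee_fin.
- by rewrite lee_fin; apply: prodr_ge0 => i /andP[iK _]; exact: c0.
Qed.

Lemma integral_prod_independent (f : I -> R -> R) (m : I -> R) (K : {set I}) :
  (forall i, measurable_fun setT (f i)) -> (forall i x, 0 <= f i x) ->
  (forall i, i \in K -> (\int[P]_w (f i (X i w))%:E = (m i)%:E)%E) ->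
  K \subset J ->
  (\int[P]_w (\prod_(i in K) f i (X i w))%:E = (\prod_(i in K) m i)%:E)%E.
Proof.
move=> mf f0 fm KJ.
(* Along [enum I] every factor is converted, so the sets [setT] are only a default value. *)
have := @integral_prod_independent_aux f m K (enum I) (fun=> setT) mf f0 fm KJ
  (fun=> measurableT).
under [X in _ = X%:E]eq_bigr do rewrite mem_enum.
move=> <-; apply: eq_integral => w _; congr EFin.
by apply: eq_bigr => i _; rewrite mem_enum.
Qed.

End Independence.

(** * Elementary inequalities for exponentials *)

Section ExponentialInequalities.
Variable R : realType.
Implicit Types x s a e : R.

Lemma ge0_derive_le (f g : R -> R) x :
  (forall z : R, is_derive z (1 : R) f (g z)) -> (forall z, 0 <= z -> 0 <= g z) ->
  0 <= x -> f 0 <= f x.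
Proof.
move=> df g0 x0; apply: (@ger0_derive1_ndecry R f 0) => //.
- by move=> z; rewrite in_itv/= andbT => z0; rewrite derive1E derive_val g0// ltW.
- apply: continuous_subspaceT => z.
  by apply/differentiable_continuous/derivable1_diffP.
Qed.

Let derive_expRN x : is_derive x (1:R) (fun z => expR (- z)) (- expR (- x)).
Proof.
have h := @is_derive1_comp R expR (fun z : R => - z) x (expR (- x)) (- 1)
  (is_derive_expR _) _.
by apply: is_derive_eq; rewrite mulrN1.
Qed.

(** The difference of the two sides vanishes at 0 and has derivative [x * (expR x - expR (- x))]. *)
Lemma le_sinh_cosh x : 0 <= x -> expR x - expR (- x) <= x * (expR x + expR (- x)).
Proof.
move=> x0.
have := @ge0_derive_le (fun z => z * (expR z + expR (- z)) - (expR z - expR (- z)))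
  (fun z => z * (expR z - expR (- z))) x.
rewrite mul0r oppr0 subrr subr0 subr_ge0; apply => // z.
  by apply: is_derive_eq; rewrite /GRing.scale/=; ring.
by move=> z0; rewrite mulr_ge0// subr_ge0 ler_expR; lra.
Qed.

(** In logarithms, the difference of the two sides has derivative [x - tanh x], nonnegative for
    [x >= 0] by the previous inequality; evenness covers [x < 0]. *)
Lemma cosh_le_expR x : (expR x + expR (- x)) / 2 <= expR (x ^+ 2 / 2).
Proof.
wlog x0 : x / 0 <= x.
  move=> H; have [|x0] := leP 0 x; first exact: H.
  by have := H (- x); rewrite opprK sqrrN addrC; apply; rewrite oppr_ge0 ltW.
have c0 (z : R) : 0 < expR z + expR (- z) by rewrite addr_gt0// expR_gt0.
have := @ge0_derive_le (fun z => z ^+ 2 / 2 - ln (expR z + expR (- z)))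
  (fun z => z - (expR z + expR (- z))^-1 * (expR z - expR (- z))) x.
have d (z : R) : is_derive z (1 : R) (fun z => ln (expR z + expR (- z)))
    ((expR z + expR (- z))^-1 * (expR z - expR (- z))).
  have h1 := is_derive1_ln (c0 z).
  have h2 : is_derive z (1 : R) (fun z => expR z + expR (- z)) (expR z - expR (- z)).
    by apply: is_derive_eq; rewrite /GRing.scale/=; ring.
  exact: (@is_derive1_comp R (@ln R) (fun z => expR z + expR (- z)) z _ _ h1 h2).
have key : 0 ^+ 2 / 2 - ln (expR 0 + expR (- 0)) <= x ^+ 2 / 2 - ln (expR x + expR (- x)) ->
    (expR x + expR (- x)) / 2 <= expR (x ^+ 2 / 2).
  rewrite oppr0 expR0 expr0n/= mul0r sub0r => h.
  have h2 : ln (expR x + expR (- x)) <= x ^+ 2 / 2 + ln (1 + 1) by lra.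
  rewrite -ler_expR expRD !lnK ?posrE// in h2.
  by rewrite ler_pdivrMr//; apply: le_trans h2 _; rewrite (_ : 1 + 1 = 2)//; ring.
move=> H; apply: key; apply: H => // z.
  apply: is_derive_eq; rewrite /GRing.scale/=; field; exact/lt0r_neq0.
by move=> z0; rewrite subr_ge0 mulrC ler_pdivrMr// le_sinh_cosh.
Qed.

(** Convexity: add, with weights [t] and [1 - t], the tangent inequalities at [s * e] evaluated at
    the two endpoints. The chord is written with its linear part in [e] apart, so that this part
    vanishes on average for centered [e]. *)
Lemma expR_le_chord a e s : 0 < a -> `|e| <= a ->
  expR (s * e) <= (expR (s * a) + expR (- (s * a))) / 2
    + e * ((expR (s * a) - expR (- (s * a))) / (2 * a)).
Proof.
move=> a0; rewrite ler_norml => /andP[ea ae].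
pose z := s * e; pose A := s * a; pose t : R := (e + a) / (2 * a).
have t0 : 0 <= t by rewrite divr_ge0//; lra.
have t1 : 0 <= 1 - t by rewrite subr_ge0 ler_pdivrMr; lra.
have tangent u : expR z * (1 + (u - z)) <= expR u.
  have -> : expR u = expR z * expR (u - z) by rewrite -expRD; congr expR; ring.
  by rewrite ler_pM2l ?expR_gt0// expR_ge1Dx.
have := ler_wpM2l t0 (tangent A); have := ler_wpM2l t1 (tangent (- A)) => h1 h2.
have -> : (expR A + expR (- A)) / 2 + e * ((expR A - expR (- A)) / (2 * a)) =
    t * expR A + (1 - t) * expR (- A).
  by rewrite /t; field; rewrite gt_eqF.
have <- : t * (expR z * (1 + (A - z))) + (1 - t) * (expR z * (1 + (- A - z))) = expR z.
  rewrite [LHS](_ : _ = expR z * (1 + ((2 * t - 1) * A - z))); last by ring.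
  rewrite (_ : (2 * t - 1) * A - z = 0) ?addr0 ?mulr1//.
  by rewrite /t /A /z; field; rewrite gt_eqF.
exact: lerD.
Qed.

End ExponentialInequalities.

(** * Markov's inequality and standard normal integrals *)

Section Gaussian.
Variable R : realType.

Lemma markov_le d (T : measurableType d) (P : probability T R) (F : T -> R) (m a : R) :
  measurable_fun setT F -> (forall w, 0 <= F w) -> 0 < a ->
  (\int[P]_w (F w)%:E = m%:E)%E ->
  measurable [set w | a <= F w] /\ (P [set w | (a <= F w)%R] <= (m / a)%:E)%E.
Proof.
move=> mF F0 a0 Fm.
have mA : measurable [set w | a <= F w].
  rewrite -[X in measurable X]setTI.
  have := @measurable_fun_ler _ _ _ setT (cst a) F (measurable_cst _) mF measurableT [set true].
  by apply.
split=> //.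
rewrite EFinM muleC lee_pdivlMl// -Fm -integral_cst//=.
rewrite integral_mkcond; apply: ge0_le_integral => //.
- by move=> w _; rewrite patchE; case: ifP => // _; rewrite lee_fin ltW.
- apply/(measurable_restrictT _ mA); exact: measurable_cst.
- by apply/measurable_EFinP.
- move=> w _; rewrite patchE; case: ifPn; first by rewrite inE lee_fin.
  by rewrite lee_fin.
Qed.

Section StandardNormal.
Context d (T : measurableType d) (P : probability T R) (X : T -> R).
Hypothesis mX : measurable_fun setT X.
Hypothesis normX : forall E : set R, measurable E -> P (X @^-1` E) = normal_prob 0 1 E.

Lemma integral_standard_normal (f : R -> R) :
  measurable_fun setT f -> (forall x, 0 <= f x) ->
  (\int[P]_w (f (X w))%:E =
   \int[lebesgue_measure]_x (normal_pdf 0 1 x * f x)%:E)%E.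
Proof.
move=> mf f0.
under eq_integral do rewrite -[f _]mul1r.
apply: (@eq_integral_weighted R _ _ _ _ P lebesgue_measure (cst 1) X
  (normal_pdf 0 1) id f) => //.
- exact: measurable_normal_pdf.
- by move=> x; exact: normal_pdf_ge0.
move=> B mB; under eq_integral do rewrite mul1r.
transitivity (P (X @^-1` B)).
  have mXB : measurable (X @^-1` B) by rewrite -[_ @^-1` _]setTI; exact: mX.
  by rewrite -[X in _ = P X]setIT -integral_indic.
rewrite normX// /normal_prob [LHS]integral_mkcond; apply: eq_integral => x _.
rewrite patchE indicE; case: ifP => _; by rewrite ?mulr1 ?mulr0.
Qed.

(** Completing the square turns the integrand into [expR (c ^+ 2 / 2)] times the normal density of
    mean [c]. *)
Lemma integral_expR_standard_normal (c : R) :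
  (\int[P]_w (expR (c * X w))%:E = (expR (c ^+ 2 / 2))%:E)%E.
Proof.
have mf : measurable_fun setT (fun x : R => expR (c * x)).
  by apply: measurableT_comp => //; exact: mulrl_measurable.
rewrite (integral_standard_normal mf); last by move=> x; exact: expR_ge0.
have e (x : R) : normal_pdf 0 1 x * expR (c * x) = expR (c ^+ 2 / 2) * normal_pdf c 1 x.
  rewrite !normal_pdfE ?oner_eq0// mulrCA -mulrA; congr (_ * _).
  rewrite /normal_fun -!expRD; congr expR; rewrite !expr1n subr0; by field.
under eq_integral do rewrite e EFinM.
rewrite ge0_integralZl//=.
- by rewrite integral_normal_pdf mule1.
- by apply/measurable_EFinP; exact: measurable_normal_pdf.
- by move=> x _; rewrite lee_fin normal_pdf_ge0.
Qed.

(** The exponential factor turns the standard density into [Num.sqrt 2] times the centered density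
    of variance 2. *)
Lemma integral_expR_sqr_standard_normal :
  (\int[P]_w (expR (X w ^+ 2 / 4))%:E = (Num.sqrt 2)%:E)%E.
Proof.
have mf : measurable_fun setT (fun x : R => expR (x ^+ 2 / 4)).
  by apply: measurableT_comp => //; apply: measurable_funM.
rewrite (integral_standard_normal mf); last by move=> x; exact: expR_ge0.
have s0 : Num.sqrt 2 != 0 :> R by rewrite gt_eqF// sqrtr_gt0.
have s2 : Num.sqrt 2 ^+ 2 = 2 :> R by rewrite sqr_sqrtr.
have pk : normal_peak 1 = Num.sqrt 2 * normal_peak (Num.sqrt 2) :> R.
  rewrite /normal_peak s2 expr1n mul1r -mulrnAr sqrtrM// invfM mulrA divff ?mul1r//.
have nf (x : R) : normal_fun 0 1 x * expR (x ^+ 2 / 4) = normal_fun 0 (Num.sqrt 2) x.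
  move: (Num.sqrt 2) s2 => s s2.
  by rewrite /normal_fun s2 -!expRD expr1n subr0; congr expR; field.
have e (x : R) : normal_pdf 0 1 x * expR (x ^+ 2 / 4) =
    Num.sqrt 2 * normal_pdf 0 (Num.sqrt 2) x.
  by rewrite !normal_pdfE ?oner_eq0// pk -[LHS]mulrA nf [RHS]mulrA.
under eq_integral do rewrite e EFinM.
rewrite ge0_integralZl//=.
- by rewrite integral_normal_pdf mule1.
- by apply/measurable_EFinP; exact: measurable_normal_pdf.
- by move=> x _; rewrite lee_fin normal_pdf_ge0.
Qed.

Lemma standard_normal_neq0 : P (X @^-1` [set 0]) = 0%E.
Proof.
rewrite normX//; exact: integral_set1.
Qed.

End StandardNormal.
End Gaussian.

(** * Union bound over a finite index type *)

Lemma union_bound (R : realType) d (T : measurableType d) (P : probability T R)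
    (I : finType) (A : I -> set T) (e : R) :
  (forall i, measurable (A i)) -> (forall i, (P (A i) <= e%:E)%E) ->
  measurable [set w | exists i, A i w] /\
  (P [set w | exists i, A i w] <= (#|I|%:R * e)%:E)%E.
Proof.
move=> mA PA; rewrite cardE.
have -> : [set w | exists i, A i w] = [set w | exists2 i, i \in enum I & A i w].
  apply/seteqP; split => w [i Ai]; first by exists i => //; rewrite mem_enum.
  by exists i.
elim: (enum I) => [|i s [mU PU]].
  rewrite (_ : mkset _ = set0) ?measure0 ?mul0r; last by apply/seteqP; split => w [].
  by split => //; exact: measurable0.
have -> : [set w | exists2 j, j \in i :: s & A j w] =
    A i `|` [set w | exists2 j, j \in s & A j w].
  apply/seteqP; split => w.
    move=> [j]; rewrite inE => /predU1P[->|js] Aj; first by left.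
    by right; exists j.
  move=> [Ai|[j js Aj]]; first by exists i => //; rewrite mem_head.
  by exists j => //; rewrite inE js orbT.
split; first exact: measurableU.
apply: le_trans (measureU2 _ _ _) _ => //.
by rewrite /= -add1n natrD mulrDl mul1r EFinD leeD.
Qed.

(** * Exponential moments and column norms of a Gaussian matrix *)

Section GaussianMatrix.
Context (R : realType) d (T : measurableType d) (P : probability T R).
Variables (M N : nat) (Phi : 'I_M -> 'I_N -> {RV P >-> R}).
Hypothesis gaussPhi : gaussian_matrix Phi.

Let mPhi i j : measurable_fun setT (Phi i j : T -> R).
Proof. exact: measurable_funPT. Qed.

Let normPhi i j (E : set R) : measurable E ->
  P ((Phi i j : T -> R) @^-1` E) = normal_prob 0 1 E.
Proof. by case: gaussPhi => _ h mE; rewrite -(h i j). Qed.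

Lemma integral_prod_gaussian_matrix (f : 'I_M -> 'I_N -> R -> R) (v : 'I_M -> 'I_N -> R) :
  (forall i j, measurable_fun setT (f i j)) -> (forall i j x, 0 <= f i j x) ->
  (forall i j, (\int[P]_w (f i j (Phi i j w))%:E = (v i j)%:E)%E) ->
  (\int[P]_w (\prod_i \prod_j f i j (Phi i j w))%:E = (\prod_i \prod_j v i j)%:E)%E.
Proof.
move=> mf f0 fv.
have := @integral_prod_independent R _ T P _ [set: 'I_M * 'I_N]%SET
  (fun ij => Phi ij.1 ij.2 : T -> R) (fun ij => mPhi ij.1 ij.2) gaussPhi.1
  (fun ij => f ij.1 ij.2) (fun ij => v ij.1 ij.2) [set: 'I_M * 'I_N]%SET
  (fun ij => mf _ _) (fun ij => f0 _ _) (fun ij _ => fv _ _) (subxx _).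
have -> : \prod_(ij in [set: 'I_M * 'I_N]%SET) v ij.1 ij.2 = \prod_i \prod_j v i j.
  by rewrite pair_bigA/=; apply: eq_bigl => ij; rewrite inE.
move=> <-.
apply: eq_integral => w _; congr EFin.
rewrite pair_bigA/=; apply: eq_bigl => ij; by rewrite inE.
Qed.

Lemma integral_expR_gaussian_matrix (c : 'I_M -> 'I_N -> R) :
  (\int[P]_w (expR (\sum_i \sum_j c i j * Phi i j w))%:E =
   (expR (\sum_i \sum_j c i j ^+ 2 / 2))%:E)%E.
Proof.
rewrite expR_sum; under [in RHS]eq_bigr do rewrite expR_sum.
rewrite -(@integral_prod_gaussian_matrix (fun i j x => expR (c i j * x)) (fun i j => expR (c i j ^+ 2 / 2))).
- apply: eq_integral => w _; rewrite expR_sum; congr EFin.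
  by apply: eq_bigr => i _; rewrite expR_sum.
- by move=> i j; apply: measurableT_comp => //; exact: mulrl_measurable.
- by move=> i j x; exact: expR_ge0.
- move=> i j; apply: integral_expR_standard_normal => //; exact: normPhi.
Qed.

(** Chernoff bound with parameter 1/4: the exponential moment is [Num.sqrt 2 ^+ M], at most
    [expR M%:R], whereas the exponential exceeds [expR (3 * M%:R)] on the event. *)
Lemma column_norm_tail j :
  let A := [set w | 12 * M%:R < \sum_i Phi i j w ^+ 2] in
  measurable A /\ (P A <= (expR (- (2 * M%:R)))%:E)%E.
Proof.
move=> A.
pose F w := expR ((\sum_i Phi i j w ^+ 2) / 4).
have mS : measurable_fun setT (fun w => \sum_i Phi i j w ^+ 2).
  by apply: measurable_sum => i; apply: measurable_funX.
have mF : measurable_fun setT F.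
  by apply: measurableT_comp => //; apply: measurable_funM.
have s1 : 1 <= Num.sqrt 2 :> R by rewrite -[leLHS]sqrtr1 ler_wsqrtr// ler1n.
have FE : (\int[P]_w (F w)%:E = (Num.sqrt 2 ^+ M)%:E)%E.
  have := @integral_prod_gaussian_matrix
    (fun i k x => if k == j then expR (x ^+ 2 / 4) else 1)
    (fun i k => if k == j then Num.sqrt 2 else 1).
  have pE (a : 'I_N -> R) : \prod_k (if k == j then a k else 1) = a j.
    by rewrite -big_mkcond big_pred1_eq.
  under [X in _ = X%:E]eq_bigr do rewrite (pE (fun=> Num.sqrt 2)).
  rewrite prodr_const card_ord => <-.
  - apply: eq_integral => w _; rewrite /F mulr_suml expR_sum; congr EFin.
    by apply: eq_bigr => i _; rewrite (pE (fun k => expR (Phi i k w ^+ 2 / 4))).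
  - move=> i k; case: (k == j); last exact: measurable_cst.
    by apply: measurableT_comp => //; apply: measurable_funM.
  - by move=> i k x; case: ifP => // _; exact: expR_ge0.
  - move=> i k; case: (k == j); last by rewrite integral_cst//= probability_setT mule1.
    apply: integral_expR_sqr_standard_normal => //; exact: normPhi.
have mA : measurable A.
  rewrite -[A]setTI.
  by have := @measurable_fun_ltr _ _ _ setT (cst (12 * M%:R)) _ (measurable_cst _) mS measurableT [set true]; apply.
split=> //.
have [mB PB] := markov_le mF (fun w => expR_ge0 _) (expR_gt0 (3 * M%:R)) FE.
apply: (@le_trans _ _ (P [set w | (expR (3 * M%:R) <= F w)%R])).
  by apply: le_measure; rewrite ?inE// => w; rewrite /A /F /= ler_expR; lra.
apply: le_trans PB _; rewrite lee_fin ler_pdivrMr ?expR_gt0// -expRD.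
have -> : - (2 * M%:R) + 3 * M%:R = M%:R * 1 :> R by ring.
rewrite expRM_natl lerXn2r ?nnegrE ?expR_ge0//.
have : Num.sqrt 2 <= 2 :> R.
  rewrite -[leRHS]ger0_norm// -sqrtr_sqr ler_wsqrtr// expr2; lra.
by move=> /le_trans; apply; exact: expR_ge1Dx.
Qed.

(** Nonzero entries make [fmax], hence the penalty, positive for any nonempty set of unsaturated
    rows. *)
Lemma entries_neq0 :
  let A := [set w | exists ij : 'I_M * 'I_N, Phi ij.1 ij.2 w = 0] in
  measurable A /\ P A = 0%E.
Proof.
have [||mA PA] := @union_bound R _ _ P _
    (fun ij : 'I_M * 'I_N => (Phi ij.1 ij.2 : T -> R) @^-1` [set 0]) 0.
- move=> ij; rewrite -[_ @^-1` _]setTI; exact: mPhi.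
- move=> ij; rewrite standard_normal_neq0//; exact: normPhi.
split; first exact: mA.
by apply/eqP; rewrite eq_le measure_ge0 andbT; move: PA; rewrite mulr0.
Qed.

End GaussianMatrix.

(** * Small-ball estimate for a fixed vector *)

Section SmallBall.
Variable R : realType.

(* Coefficients and exponents of the expansion into exponentials of
   [(1 - 2/11 (cosh s - 1))^2 + 1/20]. *)
Definition expbump_coef (k : 'I_5) : R :=
  [:: 171 / 121 + 1 / 20; - (26 / 121); - (26 / 121); 1 / 121; 1 / 121]`_k.
Definition expbump_expo (k : 'I_5) : R := [:: 0; 1; -1; 2; -2]`_k.
Definition expbump (s : R) : R := \sum_k expbump_coef k * expR (expbump_expo k * s).

Let expbump_sumE (F : R -> R) : \sum_k expbump_coef k * F (expbump_expo k) =
  (171 / 121 + 1 / 20) * F 0 - 26 / 121 * F 1 - 26 / 121 * F (-1)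
   + 1 / 121 * F 2 + 1 / 121 * F (-2).
Proof.
rewrite !big_ord_recl big_ord0 /expbump_coef /expbump_expo /=; ring.
Qed.

Lemma expbumpE s : expbump s = (13 / 11 - (expR s + expR (- s)) / 11) ^+ 2 + 1 / 20.
Proof.
rewrite /expbump (expbump_sumE (fun u => expR (u * s))).
rewrite mul0r expR0 (mul1r s) mulN1r.
have -> : expR (2 * s) = expR s ^+ 2 by rewrite (expRM_natl 2).
have -> : expR (- 2 * s) = expR (- s) ^+ 2 by rewrite mulNr -mulrN (expRM_natl 2).
have := expRxMexpNx_1 s; move: (expR s) (expR (- s)) => x z xz.
rewrite [in RHS]expr2; have -> : (13 / 11 - (x + z) / 11) * (13 / 11 - (x + z) / 11) =
  169 / 121 - 26 / 121 * (x + z) + (x ^+ 2 + z ^+ 2 + 2 * (x * z)) / 121 by field.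
by rewrite xz; field.
Qed.

Lemma expbump_ge s : 1 / 20 <= expbump s.
Proof. by rewrite expbumpE lerDr sqr_ge0. Qed.

Lemma expbump_ge_near0 s : s ^+ 2 <= 2 / 11 -> 19 / 20 <= expbump s.
Proof.
move=> s2; rewrite expbumpE.
have : (expR s + expR (- s)) / 2 <= 11 / 10.
  apply: le_trans (cosh_le_expR s) _.
  apply: (@le_trans _ _ (expR (1 / 11))); first by rewrite ler_expR; lra.
  rewrite -[leLHS]invrK -expRN -[leRHS]invrK lef_pV2 ?posrE ?invr_gt0 ?expR_gt0//.
  by apply: le_trans (expR_ge1Dx _); lra.
move: (_ + _) => x xle; nra.
Qed.

(** The mean of the bump at a centered Gaussian of variance [t]. For [t = 2 * ln 2] the exponential
    moments are 2 and 16, so the mean is rational; it lies below 9/10, which in turn lies below the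
    lower bound 19/20 near 0. *)
Lemma expbump_mean (t : R) : t = 2 * ln 2 ->
  \sum_k expbump_coef k * expR (expbump_expo k ^+ 2 * t / 2) = 191 / 220.
Proof.
move=> ->; rewrite (expbump_sumE (fun u => expR (u ^+ 2 * (2 * ln 2) / 2))).
have -> : 0 ^+ 2 * (2 * ln 2) / 2 = 0 :> R by rewrite expr0n !mul0r.
have -> : (-1) ^+ 2 * (2 * ln 2) / 2 = ln 2 :> R by field.
have -> : 1 ^+ 2 * (2 * ln 2) / 2 = ln 2 :> R by field.
have -> : (- 2) ^+ 2 * (2 * ln 2) / 2 = 4%:R * ln 2 :> R by field.
have -> : 2 ^+ 2 * (2 * ln 2) / 2 = 4%:R * ln 2 :> R by field.
by rewrite expR0 expRM_natl lnK ?posrE//; field.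
Qed.

Context d (T : measurableType d) (P : probability T R).
Variables (M N : nat) (Phi : 'I_M -> 'I_N -> {RV P >-> R}).
Hypothesis gaussPhi : gaussian_matrix Phi.

Definition row_form (v : 'cV[R]_N) (i : 'I_M) (w : T) : R := \sum_j Phi i j w * v j 0.

Lemma measurable_row_form v i : measurable_fun setT (row_form v i).
Proof.
apply: measurable_sum => j; apply: measurable_funM => //; exact: measurable_cst.
Qed.

(** Distributing the product over the sums gives one term for each choice [f] of an exponential in
    every row. Each term is the exponential of a linear form in the entries. As some coefficients
    are negative, integration term by term rests on integrability. *)
Lemma integral_prod_expbump (v : 'cV[R]_N) (th : R) :
  (\int[P]_w (\prod_i expbump (th * row_form v i w))%:E =
   ((\sum_k expbump_coef k *
      expR (expbump_expo k ^+ 2 * (th ^+ 2 * \sum_j v j 0 ^+ 2) / 2)) ^+ M)%:E)%E.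
Proof.
pose c (f : {ffun 'I_M -> 'I_5}) i j : R := expbump_expo (f i) * th * v j 0.
pose g (f : {ffun 'I_M -> 'I_5}) w := expR (\sum_i \sum_j c f i j * Phi i j w).
have mg (f : {ffun 'I_M -> 'I_5}) : measurable_fun setT (g f).
  apply: measurableT_comp => //; apply: measurable_sum => i; apply: measurable_sum => j.
  by apply: measurable_funM => //; exact: measurable_cst.
have ig (f : {ffun 'I_M -> 'I_5}) : P.-integrable setT (fun w => ((\prod_i expbump_coef (f i))%:E * (g f w)%:E)%E).
  apply: integrableZl => //; apply/integrableP; split; first exact/measurable_EFinP.
  under eq_integral do rewrite gee0_abs ?lee_fin ?expR_ge0//.
  by rewrite integral_expR_gaussian_matrix// ltry.
transitivity (\int[P]_w (\sum_(f : {ffun 'I_M -> 'I_5})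
    ((\prod_i expbump_coef (f i))%:E * (g f w)%:E)))%E.
  apply: eq_integral => w _; rewrite /expbump bigA_distr_bigA/= -sumEFin.
  apply: eq_bigr => f _; rewrite big_split/= EFinM -expR_sum; congr (_ * (expR _)%:E)%E.
  apply: eq_bigr => i _; rewrite mulrA /row_form mulr_sumr.
  by apply: eq_bigr => j _; rewrite /c; ring.
rewrite integral_sum//.
rewrite -[in RHS](card_ord M) -prodr_const bigA_distr_bigA/= -sumEFin.
apply: eq_bigr => f _; rewrite integralZl//; last first.
  apply/integrableP; split; first exact/measurable_EFinP.
  under eq_integral do rewrite gee0_abs ?lee_fin ?expR_ge0//.
  by rewrite integral_expR_gaussian_matrix// ltry.
rewrite integral_expR_gaussian_matrix// -EFinM big_split/= -expR_sum.
congr (_ * expR _)%:E; apply: eq_bigr => i _.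
rewrite mulr_sumr mulr_sumr mulr_suml; apply: eq_bigr => j _.
by rewrite /c; ring.
Qed.

(** The scale giving the form variance [2 * ln 2], as [expbump_mean] requires. *)
Definition smallball_scale (v : 'cV[R]_N) : R :=
  Num.sqrt (2 * ln 2 / \sum_j v j 0 ^+ 2).

(** Markov's inequality for the product of bumps, of mean [(191 / 220) ^+ M]; dividing 191/220 by
    9/10 gives 191/198. *)
Lemma smallball_event (v : 'cV[R]_N) : v != 0 ->
  let A := [set w | (9 / 10) ^+ M <= \prod_i expbump (smallball_scale v * row_form v i w)] in
  measurable A /\ (P A <= ((191 / 198) ^+ M)%:E)%E.
Proof.
move=> v0 A.
have V0 := cV_sqr_sum_gt0 v0.
have ln20 : 0 <= ln 2 :> R by rewrite ln_ge0// ler1n.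
have mF : measurable_fun setT (fun w => \prod_i expbump (smallball_scale v * row_form v i w)).
  apply: measurable_prod => i _; apply: measurable_sum => k.
  apply: measurable_funM; first exact: measurable_cst.
  apply: measurableT_comp => //; apply: measurable_funM; first exact: measurable_cst.
  by apply: measurable_funM; [exact: measurable_cst|exact: measurable_row_form].
have F0 w : 0 <= \prod_i expbump (smallball_scale v * row_form v i w).
  by apply: prodr_ge0 => i _; apply: le_trans (expbump_ge _); rewrite divr_ge0.
have a0 : 0 < (9 / 10 : R) ^+ M by rewrite exprn_gt0// divr_gt0.
have [mA PA] := markov_le mF F0 a0 (integral_prod_expbump v (smallball_scale v)).
split; first exact: mA.
apply: le_trans PA _; rewrite lee_fin expbump_mean; last first.
  rewrite sqr_sqrtr ?divfK ?gt_eqF//.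
  by rewrite divr_ge0// ?mulr_ge0// ltW.
rewrite -expr_div_n; apply: lerXn2r; rewrite ?nnegrE; lra.
Qed.

End SmallBall.

(** * Counting the rows with a large form *)

Section SmallBallRows.
Variable R : realType.

(* A row outside the set contributes at least 19/20 to the product, any other row
   at least 1/20, and [20 <= (19/18)^100]. *)
Lemma expbump_prod_small (M : nat) (s : 'I_M -> R) :
  \prod_i expbump (s i) < (9 / 10) ^+ M ->
  (M < 100 * #|[set i | (2 / 11 < s i ^+ 2)%R]%SET|)%N.
Proof.
move=> lt; rewrite ltnNge; apply/negP => le.
set L := [set i | _]%SET in le.
move: lt; rewrite ltNge => /negP; apply.
apply: (@le_trans _ _ (\prod_i (19 / 20 * (if i \in L then 19^-1 else 1)))).
  rewrite big_split/= prodr_const card_ord -big_mkcond/= prodr_const.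
  have -> : (9 / 10 : R) ^+ M = (19 / 20) ^+ M * (18 / 19) ^+ M.
    by rewrite -exprMn; congr (_ ^+ _); field.
  rewrite ler_pM2l ?exprn_gt0 ?divr_gt0//.
  apply: (@le_trans _ _ ((18 / 19) ^+ (100 * #|L|))).
    by apply: ler_wiXn2l => //; lra.
  rewrite exprM; apply: lerXn2r; rewrite ?nnegrE ?exprn_ge0 ?invr_ge0//.
  (* The power 100 is split into two powers 10 to keep the numerals small. *)
  have h10 : (18 / 19 : R) ^+ 10 <= 2 / 3 by rewrite !exprS expr0; lra.
  rewrite (_ : 100 = 10 * 10)%N// exprM.
  apply: (@le_trans _ _ ((2 / 3 : R) ^+ 10)).
    by apply: lerXn2r => //; rewrite nnegrE.
  by rewrite !exprS expr0; lra.
apply: ler_prod => i _; rewrite inE; case: ltP => h.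
  by apply/andP; split; [lra|apply: le_trans (expbump_ge _); lra].
by apply/andP; split; [lra|rewrite mulr1 expbump_ge_near0].
Qed.

(** More than [M / 100] rows have a large form and at most [M / 200] rows lie outside [I], so at
    least [M / 200] rows of [I] remain. On each of them [g i ^+ 2] exceeds the squared norm of [v]
    divided by [11 * ln 2]. *)
Lemma smallball_rows (M N : nat) (g : 'I_M -> R) (v : 'cV[R]_N) (I : {set 'I_M}) :
  0 < \sum_j v j 0 ^+ 2 ->
  \prod_i expbump (smallball_scale v * g i) < (9 / 10) ^+ M ->
  (200 * #|~: I| <= M)%N ->
  (2200 * ln 2)^-1 * M%:R * \sum_j v j 0 ^+ 2 <= \sum_(i in I) g i ^+ 2.
Proof.
move=> V0 /expbump_prod_small; set L := [set i | _]%SET => ML IM.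
set V := \sum_j _ in V0 *.
have ln20 : 0 < ln 2 :> R by rewrite ln_gt0// ltr1n.
have cL : (#|L| <= #|I :&: L| + #|~: I|)%N.
  rewrite -(cardsID I L) finset.setIC leq_add2l subset_leq_card//.
  by apply/fintype.subsetP => i; rewrite !inE => /andP[].
have cI : (M <= 200 * #|I :&: L|)%N.
  rewrite -(leq_add2r (200 * #|~: I|)) -mulnDr.
  apply: leq_trans (_ : M + M <= _)%N; first by rewrite leq_add2l.
  apply: leq_trans (_ : 200 * #|L| <= _)%N; last by rewrite leq_mul2l cL orbT.
  by rewrite addnn -mul2n (_ : 200 = 2 * 100)%N// -mulnA leq_mul2l ltnW ?orbT.
apply: (@le_trans _ _ (\sum_(i in I :&: L) (V / (11 * ln 2)))).
  rewrite sumr_const -[leRHS]mulr_natl.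
  have : M%:R <= 200 * #|I :&: L|%:R :> R by rewrite -natrM ler_nat.
  have W0 : 0 <= V / (11 * ln 2) by rewrite divr_ge0// ltW// mulr_gt0.
  move/(ler_wpM2r W0).
  rewrite [X in _ -> X <= _](_ : _ = (M%:R * (V / (11 * ln 2))) / 200); last first.
    by field; rewrite gt_eqF.
  by rewrite ler_pdivrMr// => h; apply: le_trans h _; rewrite [leRHS]mulrC [leRHS]mulrA.
rewrite [leRHS](bigID (mem L))/=.
apply: ler_wpDr; first by apply: sumr_ge0 => i _; exact: sqr_ge0.
rewrite (eq_bigl (fun i => (i \in I) && (i \in L))); last by move=> i; rewrite inE.
apply: ler_sum => i /andP[_]; rewrite inE exprMn sqr_sqrtr; last first.
  by rewrite divr_ge0 ?mulr_ge0// ltW.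
rewrite -/V => h; rewrite ler_pdivrMr ?mulr_gt0//.
move: h; rewrite mulrAC ltr_pdivlMr// => h.
have -> : V = 11 / 2 * (2 / 11 * V) by field.
by apply: (@le_trans _ _ (11 / 2 * (2 * ln 2 * g i ^+ 2))); [rewrite ler_pM2l ?divr_gt0// ltW|lra].
Qed.

End SmallBallRows.

(** * Hoeffding's inequality for the quantization errors *)

Section Hoeffding.
Context (R : realType) d (T : measurableType d) (P : probability T R).

(** Hoeffding's lemma: integrate the chord bound, where the linear term has mean 0, and bound the
    remaining hyperbolic cosine by [cosh_le_expR]. *)
Lemma bounded_centered_mgf (e : T -> R) (D u : R) :
  measurable_fun setT e -> 0 < D -> (forall w, `|e w| <= D / 2) ->
  ('E_P[e] = 0)%E ->
  (\int[P]_w (expR (u * e w))%:E <= (expR (u ^+ 2 * D ^+ 2 / 8))%:E)%E.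
Proof.
move=> me D0 eD Ee.
pose A := (expR (u * (D / 2)) + expR (- (u * (D / 2)))) / 2.
pose B := (expR (u * (D / 2)) - expR (- (u * (D / 2)))) / (2 * (D / 2)).
have ie : P.-integrable setT (EFin \o e).
  apply: (@le_integrable _ _ _ P setT measurableT _ (cst (D / 2)%:E)).
  - exact/measurable_EFinP.
  - move=> w _ /=; rewrite lee_fin; apply: le_trans (eD w) _; exact: ler_norm.
  - exact: finite_measure_integrable_cst.
apply: (@le_trans _ _ (\int[P]_w (A%:E + B%:E * (e w)%:E))%E).
  apply: le_integral => //.
  - apply: (@le_integrable _ _ _ P setT measurableT _ (cst (expR (`|u| * (D / 2)))%:E)).
    + apply/measurable_EFinP; apply: measurableT_comp => //.
      by apply: measurable_funM.
    + move=> w _ /=; rewrite lee_fin [leLHS]ger0_norm ?expR_ge0// [leRHS]ger0_norm ?expR_ge0// ler_expR.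
      apply: le_trans (ler_norm _) _; rewrite normrM ler_wpM2l//.
    + exact: finite_measure_integrable_cst.
  - apply: integrableD => //; first exact: finite_measure_integrable_cst.
    exact: integrableZl.
  - move=> w _; rewrite -EFinM -EFinD lee_fin.
    have D20 : 0 < D / 2 by rewrite divr_gt0.
    by rewrite [B * _]mulrC; exact: (expR_le_chord u D20 (eD w)).
rewrite integralD//=; last 2 first.
- exact: finite_measure_integrable_cst.
- exact: integrableZl.
rewrite integralZl// integral_cst//= probability_setT mule1.
move: Ee; rewrite unlock => ->; rewrite mule0 adde0 lee_fin.
apply: le_trans (cosh_le_expR _) _; rewrite ler_expR le_eqVlt; apply/orP; left.
by apply/eqP; field.
Qed.

Variables (M : nat) (J : {set 'I_M}) (e : 'I_M -> T -> R) (D : R).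
Hypothesis me : forall i, measurable_fun setT (e i).
Hypothesis inde : mutually_independent P J e.
Hypothesis D0 : 0 < D.
Hypothesis eD : forall i w, i \in J -> `|e i w| <= D / 2.
Hypothesis Ee : forall i, i \in J -> ('E_P[e i] = 0)%E.

Lemma hoeffding_one_sided (a : 'I_M -> R) (r : R) :
  let V := \sum_(i in J) a i ^+ 2 in 0 < V -> 0 <= r ->
  measurable [set w | r <= \sum_(i in J) a i * e i w] /\
  (P [set w | (r <= \sum_(i in J) a i * e i w)%R] <=
     (expR (- (2 * r ^+ 2 / (D ^+ 2 * V))))%:E)%E.
Proof.
move=> V V0 r0.
have mS : measurable_fun setT (fun w => \sum_(i in J) a i * e i w).
  under eq_fun do rewrite -big_filter.
  by apply: measurable_sum => i; apply: measurable_funM.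
have DV : 0 < D ^+ 2 * V by rewrite mulr_gt0 ?exprn_gt0.
(* The minimizer of the Chernoff exponent [s ^+ 2 * D ^+ 2 * V / 8 - s * r]. *)
pose s := 4 * r / (D ^+ 2 * V).
have s0 : 0 <= s by rewrite divr_ge0 ?mulr_ge0// ltW.
pose m i := fine (\int[P]_w (expR (s * a i * e i w))%:E)%E.
have I0 i : (0 <= \int[P]_w (expR (s * a i * e i w))%:E)%E.
  by apply: integral_ge0 => w _; rewrite lee_fin expR_ge0.
have Ile i : i \in J -> (\int[P]_w (expR (s * a i * e i w))%:E <=
    (expR ((s * a i) ^+ 2 * D ^+ 2 / 8))%:E)%E.
  by move=> iJ; apply: bounded_centered_mgf => //; [move=> w; exact: eD|exact: Ee].
have Im i : i \in J -> (\int[P]_w (expR (s * a i * e i w))%:E = (m i)%:E)%E.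
  move=> iJ; rewrite fineK// ge0_fin_numE//.
  by apply: le_lt_trans (Ile _ iJ) _; rewrite ltry.
pose F w := expR (s * \sum_(i in J) a i * e i w).
have mF : measurable_fun setT F by apply: measurableT_comp => //; apply: measurable_funM.
have FE : (\int[P]_w (F w)%:E = (\prod_(i in J) m i)%:E)%E.
  rewrite -(@integral_prod_independent _ _ _ P _ J e me inde
      (fun i x => expR (s * a i * x)) m J) => //.
  - apply: eq_integral => w _; congr EFin; rewrite /F mulr_sumr expR_sum.
    by apply: eq_bigr => i _; rewrite mulrA.
  - by move=> i; apply: measurableT_comp => //; exact: mulrl_measurable.
case: (boolP (s == 0)) => [/eqP s00|sN0].
  have r00 : r = 0.
    have -> : r = s * (D ^+ 2 * V) / 4 by rewrite /s; field; rewrite (gt_eqF V0) (gt_eqF D0).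
    by rewrite s00 !mul0r.
  have mA : measurable [set w | r <= \sum_(i in J) a i * e i w].
    rewrite -[X in measurable X]setTI.
    by have := @measurable_fun_ler _ _ _ setT (cst r) _ (measurable_cst _) mS measurableT [set true]; apply.
  split=> //; rewrite r00 expr0n/= mulr0 mul0r oppr0 expR0.
  by rewrite r00 in mA; exact: probability_le1.
have sp : 0 < s by rewrite lt0r sN0.
have [mA PA] := markov_le mF (fun w => expR_ge0 _) (expR_gt0 (s * r)) FE.
have eA : [set w | expR (s * r) <= F w] = [set w | r <= \sum_(i in J) a i * e i w].
  by apply/funext => w; apply/propext; rewrite /= /F ler_expR ler_pM2l.
rewrite eA in mA PA; split=> //; apply: le_trans PA _.
rewrite lee_fin ler_pdivrMr ?expR_gt0// -expRD.
apply: (@le_trans _ _ (\prod_(i in J) expR ((s * a i) ^+ 2 * D ^+ 2 / 8))).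
  apply: ler_prod => i iJ; rewrite fine_ge0//=.
  by rewrite -lee_fin -Im// Ile.
rewrite -expR_sum ler_expR.
have -> : \sum_(i in J) (s * a i) ^+ 2 * D ^+ 2 / 8 = s ^+ 2 * D ^+ 2 / 8 * V.
  by rewrite /V mulr_sumr; apply: eq_bigr => i _; field.
rewrite le_eqVlt; apply/orP; left; apply/eqP; rewrite /s; field.
by rewrite (gt_eqF V0) (gt_eqF D0).
Qed.

(** The factor 9/16 is the square of the level 3/4. The two-sided bound has exponent [9 / 8 * L2],
    which is at least [L2]. If all the [a i] on [J] vanish, the strict inequality makes the event
    empty. *)
Lemma hoeffding (a : 'I_M -> R) (L2 : R) : 0 <= L2 ->
  let A := [set w | 9 / 16 * L2 * D ^+ 2 * \sum_(i in J) a i ^+ 2 <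
                    (\sum_(i in J) a i * e i w) ^+ 2] in
  measurable A -> (P A <= (2 * expR (- L2))%:E)%E.
Proof.
move=> L20 A mA; set V := \sum_(i in J) a i ^+ 2 in A mA *.
have V0 : 0 <= V by apply: sumr_ge0 => i _; exact: sqr_ge0.
have [V00|VN0] := eqVneq V 0.
  have -> : A = set0.
    apply/seteqP; split => // w; rewrite /A/= V00 mulr0 big1 ?expr0n ?ltxx// => i iJ.
    move/psumr_eq0P : V00 => /(_ (fun i _ => sqr_ge0 _) i iJ)/eqP.
    by rewrite sqrf_eq0 => /eqP ->; rewrite mul0r.
  by rewrite measure0 lee_fin mulr_ge0 ?expR_ge0.
have Vp : 0 < V by rewrite lt0r VN0.
pose r := Num.sqrt (9 / 16 * L2 * D ^+ 2 * V).
have q0 : 0 <= 9 / 16 * L2 * D ^+ 2 * V 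
  by apply: mulr_ge0 => //; apply: mulr_ge0; [lra|exact: sqr_ge0].
have r2 : r ^+ 2 = 9 / 16 * L2 * D ^+ 2 * V by rewrite sqr_sqrtr.
have r0 : 0 <= r by exact: sqrtr_ge0.
have [m1 P1] := hoeffding_one_sided Vp r0.
have Vp' : 0 < \sum_(i in J) (- a i) ^+ 2.
  by under eq_bigr do rewrite sqrrN.
have [m2 P2] := hoeffding_one_sided Vp' r0.
have bnd : expR (- (2 * r ^+ 2 / (D ^+ 2 * V))) <= expR (- L2).
  rewrite ler_expR lerN2 r2 ler_pdivlMr ?mulr_gt0 ?exprn_gt0//.
  have : 0 <= L2 * D ^+ 2 * V.
    by apply: mulr_ge0 => //; apply: mulr_ge0 => //; exact: sqr_ge0.
  by lra.
apply: (@le_trans _ _ (P ([set w | (r <= \sum_(i in J) a i * e i w)%R] `|`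
    [set w | (r <= \sum_(i in J) - a i * e i w)%R]))).
  apply: le_measure; rewrite ?inE//; first exact: measurableU.
  move=> w; rewrite /A/= -r2 => h.
  have : r <= `|\sum_(i in J) a i * e i w|.
    by rewrite -(@ler_sqr _ r)// ?nnegrE// real_normK ?num_real// ltW.
  rewrite ler_normr => /orP[->|]; first by left.
  move=> h2; right; apply: le_trans h2 _; rewrite -sumrN.
  by apply: ler_sum => i _; rewrite mulNr.
apply: le_trans (measureU2 _ _ _) _ => //.
rewrite mulr_natl mulr2n EFinD; apply: leeD.
  by apply: le_trans P1 _; rewrite lee_fin.
apply: le_trans P2 _; rewrite lee_fin; under eq_bigr do rewrite sqrrN; exact: bnd.
Qed.

End Hoeffding.

(** * Deterministic recovery bound *)

Section Recovery.
Variable R : realType.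

Lemma smallball_rows_exists : exists k : R, [/\ 0 < k, k <= 1 &
  forall (M N : nat) (g : 'I_M -> R) (v : 'cV[R]_N) (I : {set 'I_M}), v != 0 ->
  \prod_i expbump (smallball_scale v * g i) < (9 / 10) ^+ M ->
  (200 * #|~: I| <= M)%N ->
  k * M%:R * \sum_j v j 0 ^+ 2 <= \sum_(i in I) g i ^+ 2].
Proof.
have ln20 : 1 / 2 <= ln 2 :> R.
  rewrite -ler_expR lnK ?posrE// -[leRHS]invrK -[leLHS]invrK -expRN.
  rewrite lef_pV2 ?posrE ?invr_gt0 ?expR_gt0//.
  by apply: le_trans (expR_ge1Dx _); lra.
have k0 : 0 < 2200 * ln 2 :> R by lra.
exists (2200 * ln 2)^-1; split.
- by rewrite invr_gt0.
- by rewrite invf_le1; [lra|exact: k0].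
- by move=> M N g v I v0; apply: smallball_rows; exact: cV_sqr_sum_gt0.
Qed.

Lemma sum_rows_of M N (U : {set 'I_M}) (A : 'M[R]_(M, N)) (j : 'I_N) (F : R -> R) :
  \sum_k F (rows_of U A k j) = \sum_(i in U) F (A i j).
Proof. by rewrite [RHS]big_enum_val/=; apply: eq_bigr => k _; rewrite mxE. Qed.

Lemma l2norm_sqr m (v : 'cV[R]_m) : l2norm v ^+ 2 = \sum_i v i 0 ^+ 2.
Proof. by rewrite sqr_sqrtr// sumr_ge0// => i _; exact: sqr_ge0. Qed.

Lemma residual_sqr (Delta : R) B M N (A : 'M[R]_(M, N)) (y : 'cV[R]_M) (x : 'cV[R]_N) :
  l2norm (residual Delta B A y x) ^+ 2 =
  \sum_(i in unsat Delta B y) (A *m x - y) i 0 ^+ 2.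
Proof.
rewrite l2norm_sqr -(sum_rows_of _ _ _ (fun r => r ^+ 2)).
apply: eq_bigr => k _; congr (_ ^+ 2).
by rewrite !mxE; congr (_ - _); apply: eq_bigr => j _; rewrite !mxE.
Qed.

(** Since [chi] lies between 0 and 1, [ln chi <= 0] and the left-hand side is at least [chi]; hence
    [chi <= 1 / 200]. *)
Lemma card_saturated (Delta : R) B M (y : 'cV[R]_M) :
  let chi := sat_ratio Delta B y in
  (0 < M)%N -> chi * (1 - ln chi) <= 1 / 200 ->
  (200 * #|~: unsat Delta B y| <= M)%N.
Proof.
move=> chi M0; have M0' : 0 < M%:R :> R by rewrite ltr0n.
have cU : M%:R = #|unsat Delta B y|%:R + #|~: unsat Delta B y|%:R :> R.
  by rewrite -natrD cardsC card_ord.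
have chiE : chi = #|~: unsat Delta B y|%:R / M%:R.
  by rewrite /chi /sat_ratio {1}cU addrAC subrr add0r.
have chi0 : 0 <= chi by rewrite chiE divr_ge0.
have chi1 : chi <= 1 by rewrite chiE ler_pdivrMr// mul1r cU lerDr.
move=> h; have : chi <= 1 / 200.
  apply: le_trans h; rewrite -[leLHS]mulr1 ler_wpM2l// lerDl oppr_ge0.
  exact: ln_le0.
rewrite chiE ler_pdivrMr// => h2.
by rewrite -(ler_nat R) natrM; lra.
Qed.

Lemma fmax_bounds M N (U : {set 'I_M}) (A : 'M[R]_(M, N)) :
  (forall j, Num.sqrt (\sum_(i in U) A i j ^+ 2) <= fmax (rows_of U A)) /\
  forall c, 0 <= c -> (forall j, \sum_(i in U) A i j ^+ 2 <= c) ->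
    fmax (rows_of U A) <= Num.sqrt c.
Proof.
have cE j : l2norm (col j (rows_of U A)) = Num.sqrt (\sum_(i in U) A i j ^+ 2).
  rewrite /l2norm -(sum_rows_of _ _ _ (fun r => r ^+ 2)).
  by congr Num.sqrt; apply: eq_bigr => k _; rewrite [col _ _ _ _]mxE.
split=> [j|c c0 h]; first by rewrite -cE; exact: (le_bigmax _ (fun j => l2norm (col j (rows_of U A)))).
apply: bigmax_le => [|j _]; first exact: sqrtr_ge0.
by rewrite cE ler_wsqrtr.
Qed.

(** Combines [lasso_l2_bound] at [lam = lambda * Delta] with the restricted eigenvalue
    [k / 8 * M%:R]. The column bound gives [fmax <= Num.sqrt (12 * M%:R)], which turns the division
    by [M] into one by its square root. *)
Lemma recovery_bound (Delta p k : R) B M N m (A : 'M[R]_(M, N)) (y : 'cV[R]_M)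
    (xs xh : 'cV[R]_N) :
  let U := unsat Delta B y in
  let chi := sat_ratio Delta B y in
  let lam2 : R := 2 * ln (2 * N%:R / p) in
  let S := nnz xs in
  0 < k -> k <= 1 -> 0 < Delta -> (0 < M)%N -> (0 < N)%N -> 0 < lam2 ->
  (forall i j, A i j != 0) ->
  (forall j, (\sum_(i in U) A i j * (A *m xs - y) i 0) ^+ 2 <=
     9 / 16 * lam2 * Delta ^+ 2 * \sum_(i in U) A i j ^+ 2) ->
  ((0 < S)%N -> [/\ (0 < m)%N, 1024 * (12 + 1) * S%:R <= k * m%:R,
     forall j, \sum_i A i j ^+ 2 <= 12 * M%:R &
     forall (t : m.-tuple ('I_N * bool)) (I : {set 'I_M}), (200 * #|~: I| <= M)%N ->
       k * M%:R * \sum_j atom_sum R t j 0 ^+ 2 <=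
       \sum_(i in I) (A *m atom_sum R t) i 0 ^+ 2]) ->
  chi * (1 - ln chi) <= 1 / 200 ->
  feasible Delta B A y xs ->
  is_solution Delta B (lambda_of Delta B p A y) A y xh ->
  l2norm (xh - xs) <=
    32 * Num.sqrt 12 / k * Num.sqrt (lam2 * S%:R / M%:R) * Delta.
Proof.
move=> U chi lam2 S k0 k1 D0 M0 N0 lam20 A0 noise hS hchi feas [_ /(_ _ feas) opt].
have M0' : 0 < M%:R :> R by rewrite ltr0n.
have cU := card_saturated M0 hchi; rewrite -/U in cU.
have [fge fle] := fmax_bounds U A.
set f := fmax (rows_of U A) in fge fle.
(* At most [M / 200] rows are saturated, so some row is unsaturated, and its entries are nonzero. *)
have f0 : 0 < f.
  have [i iU] : exists i, i \in U.
    apply/set0Pn; rewrite -card_gt0; apply: contraTT M0; rewrite -!leqNgt leqn0 => /eqP c0.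
    have := cardsC U; rewrite c0 add0n card_ord => cE; rewrite cE in cU.
    rewrite leqNgt; apply/negP => Mp; move: cU.
    by rewrite -[leqRHS]mul1n leq_pmul2r.
  apply: lt_le_trans (fge (Ordinal N0)); rewrite sqrtr_gt0 (bigD1 i)//=.
  rewrite ltr_wpDr ?exprn_even_gt0 ?A0//.
  by apply: sumr_ge0 => l _; exact: sqr_ge0.
pose lam := Num.sqrt lam2 * f * Delta.
have lam0 : 0 < lam by rewrite !mulr_gt0// sqrtr_gt0.
have lamE : lambda_of Delta B p A y * Delta = lam by [].
have noise' j : `|\sum_(i in U) A i j * (A *m xs - y) i 0| <= 3 / 4 * lam.
  have V0 : 0 <= \sum_(i in U) A i j ^+ 2 by apply: sumr_ge0 => i _; exact: sqr_ge0.
  rewrite -(@ler_sqr _ `|_|) ?nnegrE//; last by rewrite mulr_ge0// ltW.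
  rewrite real_normK ?num_real//; apply: le_trans (noise j) _.
  have -> : (3 / 4 * lam) ^+ 2 = 9 / 16 * lam2 * Delta ^+ 2 * f ^+ 2.
    rewrite /lam !exprMn sqr_sqrtr; last exact: ltW. by field.
  rewrite ler_wpM2l//.
    by apply: mulr_ge0; [apply: mulr_ge0 => //; lra|exact: sqr_ge0].
  by rewrite -[leLHS]sqr_sqrtr// ler_sqr ?nnegrE ?sqrtr_ge0 ?fge// ltW.
have k8 : 0 < k / 8 * M%:R by rewrite mulr_gt0// divr_gt0.
have := @lasso_l2_bound R M N A y U xs xh lam (k / 8 * M%:R) lam0 k8 noise' _ _.
rewrite -/S => /(_ _ _)/le_trans; apply.
- by move: opt; rewrite /objective !residual_sqr lamE.
- move=> /hS[m0 hm hcol hatom] v hv.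
  apply: (@restricted_eigenvalue R M N m A U k 12 S%:R v) => //; first by rewrite k0.
  by move=> t; exact: hatom.
have [S0|S0] := posnP S.
  by rewrite S0 sqrtr0 mulr0 mul0r mulr0 mul0r sqrtr0 mulr0 mul0r.
have [_ _ hcol _] := hS S0.
have fle' : f <= Num.sqrt 12 * Num.sqrt M%:R.
  rewrite -sqrtrM//; apply: fle; first by rewrite mulr_ge0.
  move=> j; apply: le_trans (hcol j); rewrite [leRHS](bigID (mem U))/= lerDl.
  by apply: sumr_ge0 => i _; exact: sqr_ge0.
have -> : 4 * lam * Num.sqrt S%:R / (k / 8 * M%:R) =
   f * (32 / k * Num.sqrt lam2 * Num.sqrt S%:R / M%:R * Delta).
  by rewrite /lam; field; rewrite !gt_eqF.
apply: le_trans (_ : Num.sqrt 12 * Num.sqrt M%:R *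
   (32 / k * Num.sqrt lam2 * Num.sqrt S%:R / M%:R * Delta) <= _).
  rewrite ler_wpM2r// !mulr_ge0 ?sqrtr_ge0 ?invr_ge0 ?ltW//.
rewrite le_eqVlt; apply/orP; left; apply/eqP.
have sM : Num.sqrt M%:R != 0 :> R by rewrite gt_eqF// sqrtr_gt0.
have ME : M%:R = Num.sqrt M%:R ^+ 2 :> R by rewrite sqr_sqrtr// ltW.
have -> : Num.sqrt (lam2 * S%:R / M%:R) = Num.sqrt lam2 * Num.sqrt S%:R / Num.sqrt M%:R.
  rewrite (sqrtrM _ (mulr_ge0 (ltW lam20) (ler0n R S))) (sqrtrM _ (ltW lam20)).
  by rewrite (sqrtrV (ltW M0')).
by rewrite [X in _ / X * _]ME; field; rewrite sM gt_eqF.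
Qed.

End Recovery.

(** * The noise event on the product space *)

Lemma product_measure_le_ae (R : realType) d1 d2 (T1 : measurableType d1)
    (T2 : measurableType d2) (P1 : probability T1 R) (P2 : probability T2 R)
    (A : set (T1 * T2)) (e : R) :
  measurable A -> 0 <= e -> {ae P1, forall w1, (P2 (xsection A w1) <= e%:E)%E} ->
  ((P1 \x P2)%E A <= e%:E)%E.
Proof.
move=> mA e0 h; rewrite /product_measure1.
apply: (@le_trans _ _ (\int[P1]_w e%:E)%E); last first.
  by rewrite integral_cst//= probability_setT mule1.
apply: ae_ge0_le_integral => //.
- exact: measurable_fun_xsection.
- by apply: filterS h => w h _.
Qed.

Section NoiseEvent.
Variables (R : realType) (Delta : R) (B : nat).
Hypothesis D0 : 0 < Delta.
Context d1 d2 (T1 : measurableType d1) (T2 : measurableType d2)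
  (P1 : probability T1 R) (P2 : probability T2 R).
Variables (M N : nat) (Phi : 'I_M -> 'I_N -> {RV P1 >-> R})
  (y : 'I_M -> {mfun (T1 * T2)%type >-> R}) (xs : 'cV[R]_N).

Let A (w : T1) : 'M[R]_(M, N) := \matrix_(i, j) Phi i j w.
Let yV (w : T1 * T2) : 'cV[R]_M := \col_i y i w.

(** For almost every design the set of unsaturated rows is a constant [J], so each section of [E] is
    a union over the columns of events covered by [hoeffding], with the column as weights. The bound
    on the sections is then integrated. *)
Lemma noise_event (L : R) : 0 <= L ->
  {ae P1, forall w1, centered_independent_errors P2 Delta B (A w1) xs
     (fun w2 => yV (w1, w2))} ->
  let E := [set w | exists j : 'I_N,
    9 / 16 * L * Delta ^+ 2 * \sum_(i in unsat Delta B (yV w)) A w.1 i j ^+ 2 <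
    (\sum_(i in unsat Delta B (yV w)) A w.1 i j * (A w.1 *m xs - yV w) i 0) ^+ 2] in
  measurable E /\ ((P1 \x P2)%E E <= (N%:R * (2 * expR (- L)))%:E)%E.
Proof.
move=> L0 hae E.
pose Ej (j : 'I_N) := [set w |
    9 / 16 * L * Delta ^+ 2 * \sum_(i in unsat Delta B (yV w)) A w.1 i j ^+ 2 <
    (\sum_(i in unsat Delta B (yV w)) A w.1 i j * (A w.1 *m xs - yV w) i 0) ^+ 2].
have my i : measurable_fun setT (y i : T1 * T2 -> R) by exact: measurable_funPT.
have mP i j : measurable_fun setT (fun w : T1 * T2 => Phi i j w.1).
  by apply: (measurableT_comp _ measurable_fst); exact: measurable_funPT.
have mU i : measurable_fun setT (fun w => i \in unsat Delta B (yV w)).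
  under eq_fun do rewrite /unsat /satp /satm !inE !mxE.
  by apply: measurable_neg; apply: measurable_or; apply: measurable_fun_eqr.
have mS (F : 'I_M -> T1 * T2 -> R) : (forall i, measurable_fun setT (F i)) ->
    measurable_fun setT (fun w => \sum_(i in unsat Delta B (yV w)) F i w).
  move=> mF; under eq_fun do rewrite big_mkcond/=.
  by apply: measurable_sum => i; apply: measurable_fun_ifT.
have mEj j : measurable (Ej j).
  rewrite -[Ej j]setTI.
  have := @measurable_fun_ltr _ _ R setT
    (fun w => 9 / 16 * L * Delta ^+ 2 * \sum_(i in unsat Delta B (yV w)) A w.1 i j ^+ 2)
    (fun w => (\sum_(i in unsat Delta B (yV w)) A w.1 i j * (A w.1 *m xs - yV w) i 0) ^+ 2).
  move=> /(_ _ _ measurableT [set true]); apply => //.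
    apply: measurable_funM => //; apply: mS => i.
    by under eq_fun do rewrite mxE; apply: measurable_funX.
  apply: measurable_funX; apply: mS => i.
  under eq_fun do rewrite !mxE.
  apply: measurable_funM => //; apply: measurable_funB => //.
  apply: measurable_sum => k; under eq_fun do rewrite mxE.
  exact: measurable_funM.
have mE : measurable E.
  by have [] := @union_bound R _ _ (P1 \x P2)%E _ Ej 1 mEj
    (fun j => probability_le1 _ (mEj j)).
split=> //; apply: product_measure_le_ae => //.
apply: filterS hae => w1 [J UJ [indJ EJ bJ]].
have -> : xsection E w1 = [set w2 | exists j, Ej j (w1, w2)].
  by apply/funext => w2; apply/propext; rewrite xsectionP.
have mEj1 j : measurable [set w2 | Ej j (w1, w2)].
  rewrite (_ : mkset _ = xsection (Ej j) w1); first exact: measurable_xsection.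
  by apply/funext => w2; apply/propext; rewrite xsectionP.
have [] := @union_bound R _ _ P2 _ (fun j => [set w2 | Ej j (w1, w2)])
  (2 * expR (- L)) mEj1; last by rewrite card_ord.
move=> j.
have := @hoeffding R _ T2 P2 M J (fun i w2 => (A w1 *m xs - yV (w1, w2)) i 0) Delta _
  indJ D0 (fun i w iJ => bJ i w iJ) (fun i iJ => EJ i iJ) (fun i => A w1 i j) L L0.
have -> : [set w2 | 9 / 16 * L * Delta ^+ 2 * \sum_(i in J) A w1 i j ^+ 2 <
    (\sum_(i in J) A w1 i j * (A w1 *m xs - yV (w1, w2)) i 0) ^+ 2] =
    [set w2 | Ej j (w1, w2)].
  by apply/funext => w2; apply/propext; rewrite /Ej /= UJ.
apply => // i.
under eq_fun do rewrite !mxE.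
apply: measurable_funB => //.
exact: (measurable_fun_pair2 w1 (my i)).
Qed.

End NoiseEvent.

(** * Exceptional designs *)

Section DesignEvent.
Context (R : realType) d (T : measurableType d) (P : probability T R).
Variables (M N : nat) (Phi : 'I_M -> 'I_N -> {RV P >-> R}).
Hypothesis gaussPhi : gaussian_matrix Phi.

(** A union bound over the [N] columns and the [(2 * N) ^ m] tuples of atoms. Tuples whose atoms
    cancel to the zero vector are excluded, as they have no normalizing scale. *)
Lemma design_event m :
  let E := [set w | (exists j, 12 * M%:R < \sum_i Phi i j w ^+ 2) \/
    (exists t : m.-tuple ('I_N * bool), atom_sum R t != 0 /\
      (9 / 10) ^+ M <= \prod_i expbump
        (smallball_scale (atom_sum R t) * row_form Phi (atom_sum R t) i w))] in
  measurable E /\ (P E <= (N%:R * expR (- (2 * M%:R)) +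
                          ((2 * N) ^ m)%:R * (191 / 198) ^+ M)%:E)%E.
Proof.
move=> E.
have [] := @union_bound R _ _ P _ (fun j => [set w | 12 * M%:R < \sum_i Phi i j w ^+ 2])
  (expR (- (2 * M%:R))) (fun j => (column_norm_tail gaussPhi j).1)
  (fun j => (column_norm_tail gaussPhi j).2).
set E1 := mkset _ => mE1 PE1.
pose F (t : m.-tuple ('I_N * bool)) := [set w | atom_sum R t != 0 /\
      (9 / 10) ^+ M <= \prod_i expbump
        (smallball_scale (atom_sum R t) * row_form Phi (atom_sum R t) i w)].
have hF t : measurable (F t) /\ (P (F t) <= ((191 / 198) ^+ M)%:E)%E.
  have [t0|tN0] := eqVneq (atom_sum R t) 0.
    have -> : F t = set0 by apply/seteqP; split => // w [/=]; rewrite t0 eqxx.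
    split; first exact: measurable0.
    have q0 : 0 <= 191 / 198 :> R by lra.
    by rewrite measure0 lee_fin; exact: exprn_ge0.
  have [mA PA] := smallball_event gaussPhi tN0.
  rewrite (_ : F t = [set w | (9 / 10) ^+ M <= \prod_i expbump
        (smallball_scale (atom_sum R t) * row_form Phi (atom_sum R t) i w)]) //.
  by apply/seteqP; split => w; [case|].
have [] := @union_bound R _ _ P _ F _ (fun t => (hF t).1) (fun t => (hF t).2).
set E2 := mkset _ => mE2 PE2.
have -> : E = E1 `|` E2 by [].
split; first exact: measurableU.
apply: le_trans (measureU2 _ _ _) _ => //; rewrite EFinD; apply: leeD.
  by move: PE1; rewrite card_ord.
by move: PE2; rewrite card_tuple card_prod card_ord card_bool mulnC.
Qed.

End DesignEvent.

(** * Numerical estimates of the failure probabilities *)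

Section RecoveryEvent.
Variable R : realType.

Lemma expR_opp_le_inv (c x : R) : 0 < c -> 0 < x -> expR (- (c * x)) <= (c * x)^-1.
Proof.
move=> c0 x0; have cx : 0 < c * x by exact: mulr_gt0.
rewrite expRN lef_pV2 ?posrE ?expR_gt0//.
by apply: le_trans (expR_ge1Dx _); rewrite lerDr.
Qed.

(** Here [ln (191 / 198) <= - (7 / 198)], and the number of tuples is at most
    [expR (7 / 396 * M%:R)], which costs half of this rate. What remains is at most [396 / (7 * M)],
    below [57 / M]; the columns add [1 / M]. *)
Lemma design_tail (K S N M : nat) : (1 < N)%N -> (0 < M)%N -> (0 < S)%N ->
  S%:R * ln N%:R <= M%:R :> R -> 2 * K%:R * (S%:R * ln N%:R) <= 7 / 396 * M%:R :> R ->
  N%:R * expR (- (2 * M%:R)) + ((2 * N) ^ (K * S))%:R * (191 / 198) ^+ M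
    <= 58 / M%:R :> R.
Proof.
move=> N1 M0 S0 h1 h2; have M0' : 0 < M%:R :> R by rewrite ltr0n.
have N0' : 0 < N%:R :> R by rewrite ltr0n ltnW.
have lnN0 : 0 <= ln N%:R :> R by rewrite ln_ge0// ler1n ltnW.
have a : N%:R * expR (- (2 * M%:R)) <= M%:R^-1 :> R.
  apply: (@le_trans _ _ (expR (- M%:R))); last first.
    by have := expR_opp_le_inv ltr01 M0'; rewrite mul1r.
  rewrite -{1}(@lnK _ N%:R) ?posrE// -expRD ler_expR.
  have : ln N%:R <= S%:R * ln N%:R :> R.
    by rewrite -[leLHS]mul1r ler_wpM2r// ler1n.
  by lra.
have b : ((2 * N) ^ (K * S))%:R * (191 / 198) ^+ M <= 57 / M%:R :> R.
  have e1 : ((2 * N) ^ (K * S))%:R <= expR (2 * K%:R * (S%:R * ln N%:R)) :> R.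
    have N20 : 0 < (2 * N)%:R :> R by rewrite ltr0n muln_gt0/=; exact: ltnW.
    rewrite natrX -[X in X ^+ _](lnK N20) -expRM_natl ler_expR natrM.
    have -> : 2 * K%:R * (S%:R * ln N%:R) = K%:R * S%:R * (2 * ln N%:R) :> R by ring.
    have l2 : ln (2 * N)%:R <= 2 * ln N%:R :> R.
      have -> : 2 * ln N%:R = ln N%:R + ln N%:R :> R by ring.
      rewrite natrM lnM ?posrE// lerD2r.
      by rewrite ler_ln ?posrE// ler_nat.
    by apply: ler_wpM2l l2; apply: mulr_ge0; exact: ler0n.
  have e2 : (191 / 198 : R) ^+ M <= expR (- (7 / 198 * M%:R)).
    have -> : - (7 / 198 * M%:R) = M%:R * - (7 / 198) :> R by ring.
    rewrite expRM_natl; have h : 191 / 198 <= expR (- (7 / 198)) :> R.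
      by apply: le_trans (expR_ge1Dx _); lra.
    have q0 : 0 <= 191 / 198 :> R by lra.
    by apply: lerXn2r h; rewrite nnegrE ?expR_ge0.
  apply: (@le_trans _ _ (expR (- (7 / 396 * M%:R)))).
    apply: (@le_trans _ _ (expR (7 / 396 * M%:R) * expR (- (7 / 198 * M%:R)))).
      have q0 : 0 <= 191 / 198 :> R by lra.
      apply: ler_pM (ler0n _ _) (exprn_ge0 M q0) _ e2.
      by apply: le_trans e1 _; rewrite ler_expR.
    by rewrite -expRD ler_expR; lra.
  have c0 : 0 < 7 / 396 :> R by lra.
  apply: le_trans (expR_opp_le_inv c0 M0') _.
  have Mi0 : 0 <= M%:R^-1 :> R by rewrite invr_ge0 ltW.
  have -> : (7 / 396 * M%:R)^-1 = 396 / 7 * M%:R^-1 :> R by field; rewrite gt_eqF.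
  by apply: ler_wpM2r Mi0 _ _ _; lra.
have -> : 58 / M%:R = M%:R^-1 + 57 / M%:R :> R by ring.
exact: lerD.
Qed.

(** The exponential equals [(p / (2 * N)) ^+ 2]: the factor 2 in front of the logarithm supplies the
    second power of [N], which absorbs the union over the columns. *)
Lemma noise_tail (p : R) (N : nat) : 0 < p < 1 -> (0 < N)%N ->
  N%:R * (2 * expR (- (2 * ln (2 * N%:R / p)))) <= N%:R^-1.
Proof.
move=> /andP[p0 p1] N0; have N0' : 0 < N%:R :> R by rewrite ltr0n.
have q0 : 0 < 2 * N%:R / p by rewrite divr_gt0// mulr_gt0.
rewrite expRN (expRM_natl 2) lnK ?posrE//.
have -> : N%:R * (2 * ((2 * N%:R / p) ^+ 2)^-1) = p ^+ 2 / 2 * N%:R^-1.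
  by field; rewrite (gt_eqF p0) (gt_eqF N0').
rewrite -[leRHS]mul1r ler_wpM2r ?invr_ge0 ?ltW//; nra.
Qed.

End RecoveryEvent.

(** * The recovery event in fixed dimensions *)

Section FixedDimensions.
Variables (R : realType) (k p Delta : R) (K B : nat).
Hypotheses (k0 : 0 < k) (k1 : k <= 1) (p01 : 0 < p < 1) (D0 : 0 < Delta).
Hypothesis hk : forall (M N : nat) (g : 'I_M -> R) (v : 'cV[R]_N) (I : {set 'I_M}),
  v != 0 -> \prod_i expbump (smallball_scale v * g i) < (9 / 10) ^+ M ->
  (200 * #|~: I| <= M)%N ->
  k * M%:R * \sum_j v j 0 ^+ 2 <= \sum_(i in I) g i ^+ 2.
Hypothesis hK : 1024 * (12 + 1) <= k * K%:R.
Context d1 d2 (T1 : measurableType d1) (T2 : measurableType d2)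
  (P1 : probability T1 R) (P2 : probability T2 R).
Variables (M N : nat) (Phi : 'I_M -> 'I_N -> {RV P1 >-> R})
  (y : 'I_M -> {mfun (T1 * T2)%type >-> R}) (xs : 'cV[R]_N).
Let A (w : T1) : 'M[R]_(M, N) := \matrix_(i, j) Phi i j w.
Let yV (w : T1 * T2) : 'cV[R]_M := \col_i y i w.
Let S := nnz xs.
Let C := 64 * Num.sqrt 12 / k.

Lemma recovery_event :
  2 / p <= N%:R -> (0 < M)%N ->
  ((0 < S)%N -> S%:R * ln N%:R <= M%:R :> R /\
                2 * K%:R * (S%:R * ln N%:R) <= 7 / 396 * M%:R :> R) ->
  gaussian_matrix Phi ->
  {ae P1, forall w1, centered_independent_errors P2 Delta B (A w1) xs
     (fun w2 => yV (w1, w2))} ->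
  exists G : set (T1 * T2), [/\ measurable G,
    forall w, G w ->
      let chi := sat_ratio Delta B (yV w) in
      chi * (1 - ln chi) <= 1 / 200 ->
      feasible Delta B (A w.1) (yV w) xs ->
      forall xhat : 'cV[R]_N,
      is_solution Delta B (lambda_of Delta B p (A w.1) (yV w)) (A w.1) (yV w) xhat ->
      l2norm (xhat - xs) <=
        Num.min (C * Num.sqrt (S%:R * ln N%:R / M%:R)) C * Delta &
    ((1 - (58 / M%:R + N%:R^-1))%:E <= (P1 \x P2)%E G)%E].
Proof.
move=> Np M0 hS gaussPhi hae.
have /andP[p0 p1] := p01.
have M0' : 0 < M%:R :> R by rewrite ltr0n.
have N2 : 2 < N%:R :> R.
  by apply: lt_le_trans Np; rewrite ltr_pdivlMr// gtr_pMr.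
have N1 : (1 < N)%N by apply: ltnW; rewrite -(ltr_nat R).
have N0 : (0 < N)%N by exact: ltnW.
have N0' : 0 < N%:R :> R by rewrite ltr0n.
have lnN0 : 0 <= ln N%:R :> R by rewrite ln_ge0// ler1n.
pose L : R := 2 * ln (2 * N%:R / p).
have q1 : 1 < 2 * N%:R / p by rewrite ltr_pdivlMr//; lra.
have L0 : 0 < L by rewrite mulr_gt0// ln_gt0.
(* From [2 / p <= N] the argument of the logarithm is at most the square of [N]; this removes [p]
   from the final constant. *)
have LN : L <= 4 * ln N%:R.
  have q2 : 2 * N%:R / p <= N%:R * N%:R by rewrite mulrAC ler_wpM2r.
  have -> : 4 * ln N%:R = 2 * (ln N%:R + ln N%:R) :> R by ring.
  have q0 : 0 < 2 * N%:R / p by exact: lt_trans ltr01 q1.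
  have NN : 0 < N%:R * N%:R :> R by exact: mulr_gt0.
  by rewrite ler_pM2l// -lnM ?posrE// ler_ln ?posrE.
have [mZ PZ] := entries_neq0 gaussPhi; set EZ := mkset _ in mZ PZ.
have [mD PD] := design_event gaussPhi (K * S); set ED := mkset _ in mD PD.
have [mN PN] := noise_event D0 (ltW L0) hae; set EN := mkset _ in mN PN.
(* The count of atoms [K * S] and [design_tail] require [S > 0]. For [S = 0] the recovery bound asks
   nothing of this event, which is replaced by the empty set. *)
pose ED' : set T1 := if (0 < S)%N then ED else set0.
have mD' : measurable ED' by rewrite /ED'; case: ifP.
have PD' : (P1 ED' <= (58 / M%:R)%:E)%E.
  rewrite /ED'; case: posnP => S0 /=; first by rewrite measure0 lee_fin divr_ge0// ltW.
  apply: le_trans PD _; rewrite lee_fin.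
  by have [h1 h2] := hS S0; exact: design_tail.
pose Bad := ((EZ `|` ED') `*` [set: T2]) `|` EN.
have mX : measurable ((EZ `|` ED') `*` [set: T2]).
  by apply: measurableX => //; exact: measurableU.
have mBad : measurable Bad by exact: measurableU.
have PBad : ((P1 \x P2)%E Bad <= (58 / M%:R + N%:R^-1)%:E)%E.
  apply: le_trans (measureU2 _ _ _) _ => //; rewrite EFinD; apply: leeD.
    have mU : measurable (EZ `|` ED') by exact: measurableU.
    apply: (@le_trans _ _ (P1 (EZ `|` ED'))).
      rewrite le_eqVlt; apply/orP; left; apply/eqP.
      etransitivity; first exact: (product_measure1E P1 P2 mU measurableT).
      by rewrite -[RHS]mule1; congr (_ * _)%E; exact: probability_setT.
    apply: le_trans (measureU2 _ _ _) _ => //.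
    rewrite -[leRHS]add0e; apply: leeD; last exact: PD'.
    by rewrite le_eqVlt; apply/orP; left; apply/eqP; exact: PZ.
  apply: le_trans PN _; rewrite lee_fin; exact: noise_tail.
exists (~` Bad); split.
- exact: measurableC.
- move=> w nBad chi hchi feas xhat sol.
  have nZ : ~ EZ w.1 by move=> h; apply: nBad; left; split => //; left.
  have nD : ~ ED' w.1 by move=> h; apply: nBad; left; split => //; right.
  have nN : ~ EN w by move=> h; apply: nBad; right.
  have bound := @recovery_bound R Delta p k B M N (K * S) (A w.1) (yV w) xs xhat
    k0 k1 D0 M0 N0 L0 _ _ _ hchi feas sol.
  have {bound} : l2norm (xhat - xs) <= 32 * Num.sqrt 12 / k *
      Num.sqrt (L * S%:R / M%:R) * Delta.
    apply: bound.
    + move=> i j; apply/eqP => Aij; apply: nZ; exists (i, j) => /=.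
      by rewrite mxE in Aij.
    + move=> j; rewrite leNgt; apply/negP => h; apply: nN; by exists j.
    + move=> S0; move: nD; rewrite /ED' S0 => nD; split.
      * rewrite muln_gt0 S0 andbT -(ltr_nat R) -(pmulr_rgt0 _ k0).
        by apply: lt_le_trans hK; lra.
      * by rewrite natrM mulrA ler_wpM2r.
      * move=> j; rewrite leNgt; apply/negP => h; apply: nD; left; exists j.
        by move: h; under eq_bigr do rewrite mxE.
      * move=> t I hI; have [->|tN0] := eqVneq (atom_sum R t) 0.
          rewrite mulmx0 big1; last by move=> j _; rewrite mxE expr0n.
          by rewrite mulr0; apply: sumr_ge0 => i _; exact: sqr_ge0.
        apply: (hk (g := fun i => (A w.1 *m atom_sum R t) i 0)) => //.
        rewrite ltNge; apply/negP => h; apply: nD; right; exists t; split => //.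
        apply: le_trans h _; rewrite le_eqVlt; apply/orP; left; apply/eqP.
        apply: eq_bigr => i _; congr (expbump (_ * _)); rewrite /row_form mxE.
        by apply: eq_bigr => j _; rewrite mxE.
  move=> /le_trans; apply; rewrite ler_wpM2r//; first exact: ltW.
  pose x : R := S%:R * ln N%:R / M%:R.
  have x0 : 0 <= x by rewrite divr_ge0 ?mulr_ge0// ltW.
  have x1 : x <= 1.
    rewrite /x; have [->|S0] := posnP S; first by rewrite !mul0r.
    by rewrite ler_pdivrMr// mul1r; have [] := hS S0.
  have C0 : 0 <= C by rewrite divr_ge0 ?mulr_ge0 ?sqrtr_ge0// ltW.
  have le1 : 32 * Num.sqrt 12 / k * Num.sqrt (L * S%:R / M%:R) <= C * Num.sqrt x.
    have -> : C * Num.sqrt x = 32 * Num.sqrt 12 / k * (2 * Num.sqrt x).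
      by rewrite /C; field; rewrite gt_eqF.
    apply: ler_wpM2l; first by rewrite divr_ge0 ?mulr_ge0 ?sqrtr_ge0// ltW.
    have s4 : Num.sqrt (4 : R) = 2.
      have -> : (4 : R) = 2 ^+ 2 by ring.
      by rewrite sqrtr_sqr ger0_norm.
    have -> : 2 * Num.sqrt x = Num.sqrt (4 * x) by rewrite (sqrtrM x (ler0n R 4)) s4.
    rewrite ler_wsqrtr// /x.
    have -> : 4 * (S%:R * ln N%:R / M%:R) = (4 * ln N%:R) * (S%:R / M%:R) :> R by ring.
    by rewrite -mulrA ler_wpM2r// divr_ge0// ltW.
  (* As [x <= 1], the same constant bounds both terms of the minimum. *)
  rewrite le_min le1/=; apply: le_trans le1 _.
  by rewrite -[leRHS]mulr1 ler_wpM2l// -sqrtr1 ler_wsqrtr.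
- rewrite (probability_setC _ mBad) EFinB leeB//.
Qed.

End FixedDimensions.

(** * Passage to the limit of growing dimensions *)

Lemma cvg_invr_natr (R : realType) (f : nat -> nat) :
  f n @[n --> \oo] --> \oo -> ((f n)%:R^-1 : R) @[n --> \oo] --> (0 : R).
Proof.
move=> foo; apply/gtr0_cvgV0; last exact/cvgrnyP.
have f0 : \forall n \near \oo, (0 < f n)%N by exact: (foo _ (nbhs_infty_ge 1)).
by near=> n; rewrite ltr0n; near: n.
Unshelve. all: by end_near.
Qed.

Lemma exists_natr_mul_ge (R : realType) (k a : R) : 0 < k ->
  exists K : nat, (0 < K)%N /\ a <= k * K%:R.
Proof.
move=> k0; exists (Num.Def.archi_bound `|a / k|).+1; split=> //.
rewrite mulrC -ler_pdivrMr//.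
apply: le_trans (ler_norm _) _; apply: ltW; apply: lt_trans (archi_boundP (normr_ge0 _)) _.
by rewrite ltr_nat.
Qed.

Unset Implicit Arguments.

Theorem mainTheorem2 (R : realType) :
  exists2 tau : R, 0 < tau &
  forall p : R, 0 < p < 1 ->
  exists C1 C2 : R, [/\ 0 < C1, 0 < C2 &
  forall (Delta : R) (B : nat), 0 < Delta -> (0 < B)%N ->
  forall (N M S : nat -> nat)
    (d1 d2 : nat -> measure_display)
    (T1 : forall n, measurableType (d1 n)) (P1 : forall n, probability (T1 n) R)
    (T2 : forall n, measurableType (d2 n)) (P2 : forall n, probability (T2 n) R)
    (Phi : forall n, 'I_(M n) -> 'I_(N n) -> {RV (P1 n) >-> R})
    (y : forall n, 'I_(M n) -> {mfun (T1 n * T2 n)%type >-> R})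
    (xstar : forall n, 'cV[R]_(N n)),
  let PhiM n (w : T1 n) : 'M[R]_(M n, N n) := \matrix_(i, j) Phi n i j w in
  let yV n (w : T1 n * T2 n) : 'cV[R]_(M n) := \col_i y n i w in
  N n @[n --> \oo] --> \oo ->
  M n @[n --> \oo] --> \oo ->
  (forall n, gaussian_matrix (Phi n)) ->
  (forall n, nnz (xstar n) = S n) ->
  (fun n => (S n)%:R * ln (N n)%:R : R) =o_\oo (fun n => (M n)%:R : R) ->
  (forall n, {ae P1 n, forall w1, centered_independent_errors (P2 n) Delta B
     (PhiM n w1) (xstar n) (fun w2 => yV n (w1, w2))}) ->
  with_high_probability (fun n => (P1 n \x P2 n)%E) (fun n => [set w |
    let chi := sat_ratio Delta B (yV n w) in
    chi * (1 - ln chi) <= tau ->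
    feasible Delta B (PhiM n w.1) (yV n w) (xstar n) ->
    forall xhat : 'cV[R]_(N n),
      is_solution Delta B (lambda_of Delta B p (PhiM n w.1) (yV n w))
        (PhiM n w.1) (yV n w) xhat ->
      l2norm (xhat - xstar n) <=
        Num.min (C1 * Num.sqrt ((S n)%:R * ln (N n)%:R / (M n)%:R)) C2 * Delta])].
Proof.
(* Half of the proportion 1/100 of rows with a large form. *)
exists (1 / 200); first by lra.
move=> p p01.
have [k [k0 k1 hk]] := smallball_rows_exists R.
have [K [K0 hK]] := exists_natr_mul_ge (1024 * (12 + 1)) k0.
have K0' : 0 < K%:R :> R by rewrite ltr0n.
(* The ratio of [S * ln N] to [M] at which counting the sums of [K * S] atoms costs at most half of
   the small-ball decay rate. *)
pose eps : R := 7 / 396 / (2 * K%:R).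
have eps0 : 0 < eps.
  have q0 : 0 < 7 / 396 :> R by lra.
  exact: divr_gt0 q0 (mulr_gt0 (ltr0Sn R 1) K0').
have eps1 : eps <= 1.
  have K1 : 1 <= K%:R :> R by rewrite ler1n.
  by rewrite /eps ler_pdivrMr ?mulr_gt0//; lra.
have eps2 : 2 * K%:R * eps = 7 / 396 by rewrite /eps; field; rewrite gt_eqF.
have C0 : 0 < 64 * Num.sqrt 12 / k.
  by rewrite divr_gt0 ?mulr_gt0 ?sqrtr_gt0.
exists (64 * Num.sqrt 12 / k), (64 * Num.sqrt 12 / k); split=> //.
move=> Delta B D0 _ N M S d1 d2 T1 P1 T2 P2 Phi y xs PhiM yV Noo Moo gaussPhi hS ho hae.
pose cond n : Prop := [/\ 2 / p <= (N n)%:R, (0 < M n)%N &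
  `|(S n)%:R * ln (N n)%:R : R| <= eps * `|(M n)%:R : R|].
have cond_near : \forall n \near \oo, cond n.
  have c1 : \forall n \near \oo, 2 / p <= (N n)%:R.
    have NR : ((N n)%:R : R) @[n --> \oo] --> +oo by exact/cvgrnyP.
    by move/cvgryPge : NR; exact.
  have c2 : \forall n \near \oo, (0 < M n)%N by exact: (Moo _ (nbhs_infty_ge 1)).
  have c3 := (eqoP _ _ _).1 ho eps eps0.
  by near=> n; split; near: n.
pose dl n : R := 58 / (M n)%:R + (N n)%:R^-1.
pose good n := [set w : T1 n * T2 n |
    let chi := sat_ratio Delta B (yV n w) in
    chi * (1 - ln chi) <= 1 / 200 ->
    feasible Delta B (PhiM n w.1) (yV n w) (xs n) ->
    forall xhat : 'cV[R]_(N n),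
      is_solution Delta B (lambda_of Delta B p (PhiM n w.1) (yV n w))
        (PhiM n w.1) (yV n w) xhat ->
      l2norm (xhat - xs n) <=
        Num.min (64 * Num.sqrt 12 / k * Num.sqrt ((S n)%:R * ln (N n)%:R / (M n)%:R))
          (64 * Num.sqrt 12 / k) * Delta].
have ex n : exists G : set (T1 n * T2 n), [/\ measurable G, G `<=` good n &
    cond n -> ((1 - dl n)%:E <= (P1 n \x P2 n)%E G)%E].
  have [[Np M0 So]|nc] := pselect (cond n); last first.
    (* For the finitely many dimensions where [cond] fails the empty set serves, as only the limit
       of the probabilities matters. *)
    by exists set0; split => //; exact: measurable0.
  have [|G [mG Gg PG]] := @recovery_event R k p Delta K B k0 k1 p01 D0 hk hK _ _ _ _
    (P1 n) (P2 n) (M n) (N n) (Phi n) (y n) (xs n) Np M0 _ (gaussPhi n) (hae n).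
    move=> S0; rewrite hS in S0 *.
    have SM : (S n)%:R * ln (N n)%:R <= eps * (M n)%:R :> R.
      by apply: le_trans (ler_norm _) _; apply: le_trans So _; rewrite normr_nat.
    split.
      by apply: le_trans SM _; rewrite -[leRHS]mul1r ler_wpM2r.
    have K20 : 0 <= 2 * K%:R :> R by apply: mulr_ge0; exact: ltW.
    by have := ler_wpM2l K20 SM; rewrite (mulrA _ eps) eps2.
  exists G; split=> //.
  by move=> w /Gg; rewrite /good/= hS.
exists (fun n => sval (cid (ex n))).
split=> [n|n|].
- by case: (svalP (cid (ex n))).
- by case: (svalP (cid (ex n))).
have dl0 : (1 - dl n)%:E @[n --> \oo] --> (1 : R)%:E.
  apply: cvg_EFin; first by near=> n.
  rewrite -[X in _ --> X]subr0; apply: cvgB; first exact: cvg_cst.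
  rewrite -[X in _ --> X]addr0; apply: cvgD; last exact: cvg_invr_natr.
  rewrite -(mulr0 58); apply: cvgM; first exact: cvg_cst.
  exact: cvg_invr_natr.
apply: (squeeze_cvge _ dl0 (@cvg_cst _ _ _ _ _)).
near=> n; apply/andP; have [mG _ PG] := svalP (cid (ex n)); split.
  by apply: PG; near: n.
exact: (@probability_le1 _ _ _ (P1 n \x P2 n)%E).
Unshelve. all: by end_near.
Qed.
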